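(* For $|q|<1$ (wherever $\psi(q)\neq0$, or equivalently after multiplying through by $\psi(q)$), $$\text{(i)}\quad \frac{\mathcal{T}_2(q)}{\psi(q)}=\mathcal{P},$$ $$\text{(ii)}\quad \frac{\mathcal{T}_4(q)}{\psi(q)}=3\mathcal{P}^2-2\mathcal{Q},$$ $$\text{(iii)}\quad \frac{\mathcal{T}_6(q)}{\psi(q)}=15\mathcal{P}^3-30\mathcal{P}\mathcal{Q}+16e\mathcal{Q},$$ $$\text{(iv)}\quad \frac{\mathcal{T}_8(q)}{\psi(q)}=105\mathcal{P}^4-420\mathcal{P}^2\mathcal{Q}+448e\mathcal{P}\mathcal{Q}-128e^2\mathcal{Q}-4\mathcal{Q}^2.$$
   Context: For $|q|<1$ and integers $k\ge1$ define $$\mathcal{T}_{2k}(q)=1+\sum_{n=1}^{\infty}(2n+1)^{2k}q^{n(n+1)/2},\qquad \psi(q)=\sum_{n=0}^{\infty}q^{n(n+1)/2},$$ $$\mathcal{P}(q)=1+8\sum_{n=1}^{\infty}\frac{(-1)^{n-1}nq^n}{1-q^n},\quad e(q)=1+24\sum_{n=1}^{\infty}\frac{nq^n}{1+q^n},\quad \mathcal{Q}(q)=1-16\sum_{n=1}^{\infty}\frac{(-1)^{n-1}n^3q^n}{1-q^n}.$$ *)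

(* Defs.v *)
From Stdlib Require Import Reals.
From Coquelicot Require Import Coquelicot.

Open Scope C_scope.

(** Sum of a complex series, selected with [iota] in the way Coquelicot's
    [RInt] selects the value of [is_RInt]; it is meaningful when the series
    converges, as all the series below do for [Cmod q < 1]. *)
Definition CSeries (a : nat -> C) : C :=
  iota (fun l : C_CompleteNormedModule => is_series a l).

Lemma CSeries_unique (a : nat -> C) (l : C_CompleteNormedModule) :
  is_series a l -> CSeries a = l.
Proof. exact (iota_filterlim_locally (sum_n a) l). Qed.

Definition CSeries_from1 (a : nat -> C) : C := CSeries (fun n => a (S n)).

(** [n (n + 1)] is even, so the truncated division is exact. *)
Definition triangular (n : nat) : nat := Nat.div (n * (n + 1)) 2.

(** [calT k] is the function usually written T with index [2 k], [k >= 1]. *)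
Definition calT (k : nat) (q : C) : C :=
  1 + CSeries_from1 (fun n =>
        RtoC (INR (2 * n + 1)) ^ (2 * k) * q ^ triangular n).

Definition psi (q : C) : C := CSeries (fun n => q ^ triangular n).

Definition calP (q : C) : C :=
  1 + 8 * CSeries_from1 (fun n =>
        (- (1)) ^ (n - 1) * RtoC (INR n) * q ^ n / (1 - q ^ n)).

Definition cale (q : C) : C :=
  1 + 24 * CSeries_from1 (fun n =>
        RtoC (INR n) * q ^ n / (1 + q ^ n)).

Definition calQ (q : C) : C :=
  1 - 16 * CSeries_from1 (fun n =>
        (- (1)) ^ (n - 1) * RtoC (INR n) ^ 3 * q ^ n / (1 - q ^ n)).

(* Main.v *)
(** Let [F(z)] be the sum over [n] in [Z] of [q^(n(n+1)/2) z^(n+1/2)] and [D = z d/dz].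
    By the triple product, [D^2 (log F)] is [g(z)], the sum over [j] in [Z] of [a(z q^j)] with
    [a(w) = w/(1+w)^2]; hence the moments [D^(2k) F] at [z = 1], which are the [T_(2k)] up to
    constants, are [psi] times polynomials in [g, D^2 g, D^4 g, D^6 g] at [1].  Expanding
    [a(w) a(cw)] in partial fractions and summing over all pairs gives
    [D^2 g = -6 g^2 + (1 - 12 s) g + const], where [s] is the sum of [q^d/(1-q^d)^2] over
    [d <> 0]; its second and fourth derivatives at [1], with [4 g = P], [-8 D^2 g = Q] and
    [12 g - (1 - 12 s) = 2 e], express [D^4 g] and [D^6 g] through [P], [e], [Q].

    Only values at [z = 1] enter, so the whole argument reduces to identities between absolutely
    convergent double sums.  In particular the relation [D F = F . (D log F)] is checked
    coefficientwise, without the triple product: it amounts to [Psi_closed]. *)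
Require Import Defs.
From Stdlib Require Import Reals Lra Lia ZArith FunctionalExtensionality.
From Coquelicot Require Import Coquelicot.

Open Scope C_scope.

(* Coquelicot's lemmas leave equations typed in a canonical structure, which [ring] rejects. *)
Ltac C_ring := match goal with |- @eq _ ?x ?y => change (@eq C x y) end; ring.

(** Two obstacles shape the argument. The partial fractions of a(w) a(c w) contain w/(1+w), which
    tends to 1 and not to 0 as w = q^j grows; it is the source of the constant in the equation for
    D^2 g. The identities are therefore stated only after applying D^2 or D^4, when every term
    decays geometrically and the constant is gone. Secondly, the term j = 0 of D (log F) is
    (z-1)/(2(z+1)), with a pole on |z| = 1, so its product with F is not a convolution of absolutely
    convergent series; it is used only after multiplication by 1+z. The terms with j <> 0 expand
    together in the annulus |q| < |z| < 1/|q|. Convergence is recorded as a geometric bound with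
    some rate 0 < r < 1 ([geo], [geoZ] and their double versions) instead of summability: polynomial
    weights, translations and skew changes of variable then cost only a larger constant or a worse
    rate. Negative powers of q force q <> 0 in all of this; q = 0 is settled by evaluating the
    series. *)

Lemma is_series_C_spec (a : nat -> C) (l : C) :
  is_series a l <->
  (forall eps : R, (0 < eps)%R -> exists N, forall n, (N <= n)%nat ->
     (Cmod (sum_n a n - l) < eps)%R).
Proof.
split.
- intros H eps Heps.
  destruct (proj1 (filterlim_locally_ball_norm (sum_n a) l) H (mkposreal eps Heps))
    as [N HN].
  exists N. intros n Hn. exact (HN n Hn).
- intros H. apply filterlim_locally_ball_norm. intros eps.
  destruct (H eps (cond_pos eps)) as [N HN]. exists N. exact HN.
Qed.

Lemma pow_small (K r eps : R) : (0 < r < 1)%R -> (0 < eps)%R ->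
  exists N, forall n, (N <= n)%nat -> (K * r ^ n < eps)%R.
Proof.
intros Hr Heps.
assert (HK : (0 < Rabs K + 1)%R) by (pose proof (Rabs_pos K); lra).
destruct (pow_lt_1_zero r) with (y := (eps / (Rabs K + 1))%R) as [N HN].
- rewrite Rabs_pos_eq; lra.
- apply Rdiv_lt_0_compat; lra.
- exists N. intros n Hn. specialize (HN n Hn).
  assert (0 <= r ^ n)%R by (apply pow_le; lra).
  rewrite Rabs_pos_eq in HN by lra.
  apply (Rmult_lt_compat_r (Rabs K + 1)) in HN; [|lra].
  replace (eps / (Rabs K + 1) * (Rabs K + 1))%R with eps in HN by (field; lra).
  pose proof (Rle_abs K). nra.
Qed.

Lemma Cmod_small_eq (x y : C) (K r : R) : (0 < r < 1)%R ->
  (forall n, (Cmod (x - y) <= K * r ^ n)%R) -> x = y.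
Proof.
intros Hr H.
destruct (Req_dec (Cmod (x - y)) 0) as [H0|H0].
- apply Cmod_eq_0 in H0. replace x with (x - y + y) by ring. rewrite H0. ring.
- pose proof (Cmod_ge_0 (x - y)).
  destruct (pow_small K r (Cmod (x - y)) Hr) as [N HN]; [lra|].
  specialize (HN N (le_n _)). specialize (H N). lra.
Qed.

(** * Series with a geometric bound *)

Definition geo (a : nat -> C) : Prop :=
  exists K r : R, (0 < r < 1)%R /\ forall n, (Cmod (a n) <= K * r ^ n)%R.

Lemma CSeries_correct (a : nat -> C) (l : C) : is_series a l -> is_series a (CSeries a).
Proof. intros H. rewrite (CSeries_unique a l H). exact H. Qed.

Lemma geo_is_series (a : nat -> C) : geo a -> is_series a (CSeries a).
Proof.
intros [K [r [Hr H]]].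
assert (He : @ex_series C_AbsRing C_CompleteNormedModule a).
{ apply ex_series_le with (b := fun n => (K * r ^ n)%R).
  - exact H.
  - apply (ex_series_scal_l (K := R_AbsRing) K (fun n => (r ^ n)%R)).
    apply ex_series_geom. rewrite Rabs_pos_eq; lra. }
destruct He as [l Hl]. exact (CSeries_correct a l Hl).
Qed.

Lemma CSeries_ext (a b : nat -> C) : (forall n, a n = b n) -> CSeries a = CSeries b.
Proof. intros H. f_equal. apply functional_extensionality, H. Qed.

Lemma CSeries_plus (a b : nat -> C) : geo a -> geo b ->
  CSeries (fun n => a n + b n) = CSeries a + CSeries b.
Proof.
intros Ha Hb. apply CSeries_unique.
exact (is_series_plus a b _ _ (geo_is_series a Ha) (geo_is_series b Hb)).
Qed.

Lemma CSeries_scal (c : C) (a : nat -> C) : geo a ->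
  CSeries (fun n => c * a n) = c * CSeries a.
Proof.
intros Ha. apply CSeries_unique.
exact (is_series_scal c a _ (geo_is_series a Ha)).
Qed.

Lemma CSeries_S (a : nat -> C) : geo a ->
  CSeries a = a O + CSeries (fun n => a (S n)).
Proof.
intros Ha.
assert (H : is_series (fun n => a (S n)) (CSeries a - a O)).
{ apply is_series_incr_1. pose proof (geo_is_series a Ha) as H.
  replace (plus _ _) with (CSeries a); [exact H|].
  change (CSeries a = CSeries a - a O + a O). ring. }
rewrite (CSeries_unique _ _ H). ring.
Qed.

Lemma geo_le (a b : nat -> C) : geo b -> (forall n, (Cmod (a n) <= Cmod (b n))%R) -> geo a.
Proof.
intros [K [r [Hr H]]] Hab. exists K, r. split; [exact Hr|].
intros n. eapply Rle_trans; [apply Hab|apply H].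
Qed.

Lemma geo_ext (a b : nat -> C) : geo a -> (forall n, b n = a n) -> geo b.
Proof. intros Ha H. apply (geo_le b a Ha). intros n. rewrite H. apply Rle_refl. Qed.

Lemma geo_K_ge0 (a : nat -> C) (K r : R) :
  (forall n, (Cmod (a n) <= K * r ^ n)%R) -> (0 <= K)%R.
Proof. intros H. specialize (H O). pose proof (Cmod_ge_0 (a O)). simpl in H. lra. Qed.

Lemma geo_plus (a b : nat -> C) : geo a -> geo b -> geo (fun n => a n + b n).
Proof.
intros [K [r [Hr H]]] [K' [r' [Hr' H']]].
exists (K + K')%R, (Rmax r r'). split.
- unfold Rmax; destruct (Rle_dec r r'); lra.
- intros n. eapply Rle_trans; [apply Cmod_triangle|].
  pose proof (geo_K_ge0 _ _ _ H). pose proof (geo_K_ge0 _ _ _ H').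
  assert (r ^ n <= Rmax r r' ^ n)%R by (apply pow_incr; pose proof (Rmax_l r r'); lra).
  assert (r' ^ n <= Rmax r r' ^ n)%R by (apply pow_incr; pose proof (Rmax_r r r'); lra).
  specialize (H n). specialize (H' n). nra.
Qed.

Lemma geo_mult_bounded (c a : nat -> C) (M : R) :
  (forall n, (Cmod (c n) <= M)%R) -> geo a -> geo (fun n => c n * a n).
Proof.
intros Hc [K [r [Hr H]]].
exists (M * K)%R, r. split; [exact Hr|]. intros n. rewrite Cmod_mult.
specialize (Hc n). specialize (H n).
pose proof (Cmod_ge_0 (c n)). pose proof (Cmod_ge_0 (a n)).
rewrite Rmult_assoc. apply Rmult_le_compat; assumption.
Qed.

Lemma geo_scal (c : C) (a : nat -> C) : geo a -> geo (fun n => c * a n).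
Proof. apply (geo_mult_bounded (fun _ => c) a (Cmod c)). intros; apply Rle_refl. Qed.

Lemma geo_S (a : nat -> C) : geo a -> geo (fun n => a (S n)).
Proof.
intros [K [r [Hr H]]]. exists (K * r)%R, r. split; [exact Hr|].
intros n. specialize (H (S n)). simpl in H. lra.
Qed.

Lemma geo_pow (x : C) : (Cmod x < 1)%R -> geo (fun n => x ^ n).
Proof.
intros Hx. pose proof (Cmod_ge_0 x).
(* The rate is not |x| itself, because a rate must be positive and x may be 0. *)
exists 1%R, ((1 + Cmod x) / 2)%R. split; [lra|].
intros n. rewrite Cmod_pow, Rmult_1_l. apply pow_incr. lra.
Qed.

(** (1 - rho^n)/(1 - rho) is a sum of n powers of rho, each at least rho^n. *)
Lemma pow_linear_bound (rho : R) (n : nat) : (0 < rho < 1)%R ->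
  (INR n * rho ^ n * (1 - rho) <= 1)%R.
Proof.
intros Hr.
assert (H : (INR n * rho ^ n * (1 - rho) <= 1 - rho ^ n)%R).
{ induction n as [|n IH].
  - simpl. lra.
  - rewrite S_INR. simpl pow.
    assert (0 <= rho ^ n)%R by (apply pow_le; lra).
    assert (INR n * (rho * rho ^ n) * (1 - rho) <= INR n * rho ^ n * (1 - rho))%R.
    { assert (0 <= INR n * rho ^ n * (1 - rho))%R.
      { apply Rmult_le_pos; [apply Rmult_le_pos|]; [apply pos_INR|assumption|lra]. }
      apply Rle_trans with (rho * (INR n * rho ^ n * (1 - rho)))%R; [apply Req_le; ring|].
      nra. }
    assert (0 <= rho ^ n * ((1 - rho) * (1 - rho)))%R
      by (apply Rmult_le_pos; [assumption|apply Rle_0_sqr]).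
    lra. }
assert (0 <= rho ^ n)%R by (apply pow_le; lra). lra.
Qed.

(* With [rho = sqrt r], one of the two factors [rho^n] absorbs the linear growth. *)
Lemma geo_rate_absorb (r : R) : (0 < r < 1)%R ->
  exists M rho : R, (0 < rho < 1)%R /\
    forall n, ((INR n + 1) * r ^ n <= M * rho ^ n)%R.
Proof.
intros Hr. set (s := sqrt r).
assert (Hs0 : (0 < s)%R) by (apply sqrt_lt_R0; lra).
assert (Hss : (s * s = r)%R) by (apply sqrt_sqrt; lra).
assert (Hs1 : (s < 1)%R) by nra.
exists (/ (1 - s) + 1)%R, s. split; [lra|]. intros n.
rewrite <- Hss, Rpow_mult_distr.
assert (0 < s ^ n)%R by (apply pow_lt; lra).
assert (s ^ n <= 1)%R by (rewrite <- (pow1 n); apply pow_incr; lra).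
assert (INR n * s ^ n <= / (1 - s))%R.
{ apply Rmult_le_reg_r with (1 - s)%R; [lra|]. rewrite Rinv_l by lra.
  apply pow_linear_bound; lra. }
apply Rle_trans with ((INR n * s ^ n + s ^ n) * s ^ n)%R; [apply Req_le; ring|].
apply Rmult_le_compat_r; lra.
Qed.

Lemma tail_bound (a : nat -> C) (K r : R) (N : nat) : (0 < r < 1)%R ->
  (forall n, (Cmod (a n) <= K * r ^ n)%R) ->
  (Cmod (CSeries a - sum_n a N) <= K / (1 - r) * r ^ S N)%R.
Proof.
intros Hr H.
assert (HK := geo_K_ge0 _ _ _ H).
assert (HM : (0 <= K / (1 - r))%R) by (apply Rdiv_le_0_compat; lra).
(* Keeping the subtracted power of r makes the bound telescope in the induction on d; it is dropped
   only when passing to the limit. *)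
assert (Hd : forall d, (Cmod (sum_n a (N + d) - sum_n a N)
                        <= K / (1 - r) * (r ^ S N - r ^ S (N + d)))%R).
{ induction d as [|d IH].
  - rewrite Nat.add_0_r.
    replace (sum_n a N - sum_n a N) with (RtoC 0) by ring. rewrite Cmod_0. lra.
  - rewrite Nat.add_succ_r, sum_Sn. change plus with Cplus.
    replace (sum_n a (N + d) + a (S (N + d)) - sum_n a N)
      with (sum_n a (N + d) - sum_n a N + a (S (N + d))) by ring.
    eapply Rle_trans; [apply Cmod_triangle|].
    specialize (H (S (N + d))).
    replace (K * r ^ S (N + d))%R
      with (K / (1 - r) * (r ^ S (N + d) - r ^ S (S (N + d))))%R in H
      by (simpl; field; lra).
    lra. }
assert (Hser : is_series a (CSeries a)) by (apply geo_is_series; exists K, r; auto).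
apply Rnot_lt_le. intros Hlt.
set (eps := (Cmod (CSeries a - sum_n a N) - K / (1 - r) * r ^ S N)%R).
destruct (proj1 (is_series_C_spec _ _) Hser eps) as [N0 HN0]; [unfold eps; lra|].
specialize (HN0 (N + N0)%nat ltac:(lia)). specialize (Hd N0).
assert (0 <= r ^ S (N + N0))%R by (apply pow_le; lra).
assert (Cmod (CSeries a - sum_n a N) <=
        Cmod (sum_n a (N + N0) - CSeries a) + Cmod (sum_n a (N + N0) - sum_n a N))%R.
{ rewrite <- (Cmod_opp (sum_n a (N + N0) - CSeries a)).
  eapply Rle_trans; [|apply Cmod_triangle]. apply Req_le. f_equal. ring. }
unfold eps in HN0. nra.
Qed.

Lemma CSeries_bound (a : nat -> C) (K r : R) : (0 < r < 1)%R ->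
  (forall n, (Cmod (a n) <= K * r ^ n)%R) -> (Cmod (CSeries a) <= K / (1 - r))%R.
Proof.
intros Hr H. pose proof (tail_bound a K r 0 Hr H) as Ht.
rewrite sum_O in Ht. specialize (H O). simpl in *.
replace (CSeries a) with (CSeries a - a O + a O) by ring.
eapply Rle_trans; [apply Cmod_triangle|].
replace (K / (1 - r))%R with (K / (1 - r) * (r * 1) + K * 1)%R by (field; lra). lra.
Qed.

Lemma Cmod_sum_n_geo (a : nat -> C) (K r : R) (N : nat) : (0 < r < 1)%R ->
  (forall n, (Cmod (a n) <= K * r ^ n)%R) -> (Cmod (sum_n a N) <= K / (1 - r))%R.
Proof.
intros Hr H. assert (HK := geo_K_ge0 _ _ _ H).
assert (HM : (0 <= K / (1 - r))%R) by (apply Rdiv_le_0_compat; lra).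
assert (Hd : (Cmod (sum_n a N) <= K / (1 - r) * (1 - r ^ S N))%R).
{ induction N as [|N IH].
  - rewrite sum_O. specialize (H O). simpl in *.
    replace (K / (1 - r) * (1 - r * 1))%R with K by (field; lra). lra.
  - rewrite sum_Sn. eapply Rle_trans; [apply Cmod_triangle|].
    specialize (H (S N)).
    replace (K * r ^ S N)%R
      with (K / (1 - r) * (r ^ S N - r ^ S (S N)))%R in H by (simpl; field; lra).
    lra. }
assert (0 <= r ^ S N)%R by (apply pow_le; lra). nra.
Qed.

(** * Double series over the naturals *)

Definition geo2 (a : nat -> nat -> C) : Prop :=
  exists K r : R, (0 < r < 1)%R /\
    forall n m, (Cmod (a n m) <= K * r ^ n * r ^ m)%R.

Lemma geo2_intro (a : nat -> nat -> C) (f g : nat -> C) : geo f -> geo g ->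
  (forall n m, (Cmod (a n m) <= Cmod (f n) * Cmod (g m))%R) -> geo2 a.
Proof.
intros [K [r [Hr H]]] [K' [r' [Hr' H']]] Hle.
exists (K * K')%R, (Rmax r r'). split.
- unfold Rmax; destruct (Rle_dec r r'); lra.
- intros n m. eapply Rle_trans; [apply Hle|].
  pose proof (geo_K_ge0 _ _ _ H). pose proof (geo_K_ge0 _ _ _ H').
  assert (r ^ n <= Rmax r r' ^ n)%R by (apply pow_incr; pose proof (Rmax_l r r'); lra).
  assert (r' ^ m <= Rmax r r' ^ m)%R by (apply pow_incr; pose proof (Rmax_r r r'); lra).
  specialize (H n). specialize (H' m).
  replace (K * K' * Rmax r r' ^ n * Rmax r r' ^ m)%R
    with ((K * Rmax r r' ^ n) * (K' * Rmax r r' ^ m))%R by ring.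
  apply Rmult_le_compat; try apply Cmod_ge_0; nra.
Qed.

Lemma sum_n_Cminus (a b : nat -> C) (N : nat) :
  sum_n (fun n => a n - b n) N = sum_n a N - sum_n b N.
Proof.
induction N as [|N IH]; [now rewrite !sum_O|].
rewrite !sum_Sn, IH. change plus with Cplus. C_ring.
Qed.

(** Two errors of equal size occur: the rows beyond N, and the truncation at N of each of the first
    rows. They account for the factor 2. *)
Lemma geo2_square (a : nat -> nat -> C) (K r : R) (N : nat) : (0 < r < 1)%R ->
  (forall n m, (Cmod (a n m) <= K * r ^ n * r ^ m)%R) ->
  (Cmod (CSeries (fun n => CSeries (a n)) - sum_n (fun n => sum_n (a n) N) N)
   <= 2 * (K / (1 - r) / (1 - r)) * r ^ S N)%R.
Proof.
intros Hr H.
assert (Hrow : forall n, (Cmod (CSeries (a n)) <= K / (1 - r) * r ^ n)%R).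
{ intros n. eapply Rle_trans.
  - apply (CSeries_bound (a n) (K * r ^ n) r Hr). apply H.
  - apply Req_le. field. lra. }
assert (H1 := tail_bound _ _ _ N Hr Hrow).
assert (H2 : (Cmod (sum_n (fun n => CSeries (a n) - sum_n (a n) N)%C N)
              <= K / (1 - r) * r ^ S N / (1 - r))%R).
{ apply Cmod_sum_n_geo; [exact Hr|]. intros n.
  eapply Rle_trans; [apply (tail_bound (a n) (K * r ^ n) r N Hr); apply H|].
  apply Req_le. field. lra. }
assert (H3 : sum_n (fun n => CSeries (a n) - sum_n (a n) N) N =
             sum_n (fun n => CSeries (a n)) N - sum_n (fun n => sum_n (a n) N) N)
  by apply sum_n_Cminus.
rewrite H3 in H2.
replace (2 * (K / (1 - r) / (1 - r)) * r ^ S N)%R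
  with (K / (1 - r) / (1 - r) * r ^ S N + K / (1 - r) * r ^ S N / (1 - r))%R
  by (field; lra).
eapply Rle_trans; [|apply Rplus_le_compat; [exact H1|exact H2]].
eapply Rle_trans; [|apply Cmod_triangle]. apply Req_le. f_equal. ring.
Qed.

(** Both iterated sums are within O(r^N) of the same finite square sum, where the order of summation
    is free. *)
Lemma CSeries_fubini (a : nat -> nat -> C) : geo2 a ->
  CSeries (fun n => CSeries (a n)) = CSeries (fun m => CSeries (fun n => a n m)).
Proof.
intros Ha. destruct Ha as [K [r [Hr H]]].
assert (H' : forall n m, (Cmod (a m n) <= K * r ^ n * r ^ m)%R)
  by (intros n m; specialize (H m n); lra).
apply (Cmod_small_eq _ _ (4 * (K / (1 - r) / (1 - r)) * r) r Hr).
intros N.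
pose proof (geo2_square a K r N Hr H) as H1.
pose proof (geo2_square (fun n m => a m n) K r N Hr H') as H2.
rewrite (sum_n_switch a N N) in H1.
match goal with |- (Cmod (?x - ?y) <= _)%R =>
  match type of H1 with (Cmod (_ - ?s) <= _)%R =>
    replace (x - y) with ((x - s) + - (y - s)) by ring end end.
eapply Rle_trans; [apply Cmod_triangle|]. rewrite Cmod_opp.
simpl pow in *. lra.
Qed.

(** * Sums over the integers *)

Definition zterm (f : Z -> C) (n : nat) : C :=
  match n with
  | O => f 0%Z
  | S _ => f (Z.of_nat n) + f (- Z.of_nat n)%Z
  end.

(** Pairing [j] with [- j] makes reflection of the index immediate; translation invariance is then
    the property that needs a proof. *)
Definition Zsum (f : Z -> C) : C := CSeries (zterm f).

Definition geoZ (f : Z -> C) : Prop :=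
  exists K r : R, (0 < r < 1)%R /\ forall j, (Cmod (f j) <= K * r ^ Z.abs_nat j)%R.

Lemma geoZ_K_ge0 (f : Z -> C) (K r : R) :
  (forall j, (Cmod (f j) <= K * r ^ Z.abs_nat j)%R) -> (0 <= K)%R.
Proof. intros H. specialize (H 0%Z). pose proof (Cmod_ge_0 (f 0%Z)). simpl in H. lra. Qed.

Lemma zterm_bound (f : Z -> C) (K r : R) (n : nat) :
  (forall j, (Cmod (f j) <= K * r ^ Z.abs_nat j)%R) ->
  (Cmod (zterm f n) <= 2 * K * r ^ n)%R.
Proof.
intros H. assert (HK := geoZ_K_ge0 _ _ _ H). destruct n as [|n].
- specialize (H 0%Z). simpl in *. lra.
- unfold zterm. eapply Rle_trans; [apply Cmod_triangle|].
  pose proof (H (Z.of_nat (S n))) as H1. pose proof (H (- Z.of_nat (S n))%Z) as H2.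
  replace (Z.abs_nat (Z.of_nat (S n))) with (S n) in H1 by lia.
  replace (Z.abs_nat (- Z.of_nat (S n))) with (S n) in H2 by lia. lra.
Qed.

Lemma geoZ_zterm (f : Z -> C) : geoZ f -> geo (zterm f).
Proof.
intros [K [r [Hr H]]]. exists (2 * K)%R, r. split; [exact Hr|].
intros n. apply zterm_bound, H.
Qed.

Lemma Zsum_ext (f g : Z -> C) : (forall j, f j = g j) -> Zsum f = Zsum g.
Proof. intros H. f_equal. apply functional_extensionality, H. Qed.

Lemma Zsum_plus (f g : Z -> C) : geoZ f -> geoZ g ->
  Zsum (fun j => f j + g j) = Zsum f + Zsum g.
Proof.
intros Hf Hg. unfold Zsum.
rewrite <- CSeries_plus by now apply geoZ_zterm.
apply CSeries_ext. intros [|n]; unfold zterm; ring.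
Qed.

Lemma Zsum_scal (c : C) (f : Z -> C) : geoZ f -> Zsum (fun j => c * f j) = c * Zsum f.
Proof.
intros Hf. unfold Zsum. rewrite <- CSeries_scal by now apply geoZ_zterm.
apply CSeries_ext. intros [|n]; unfold zterm; ring.
Qed.

Lemma Zsum_opp_index (f : Z -> C) : Zsum (fun j => f (- j)%Z) = Zsum f.
Proof.
apply CSeries_ext. intros [|n]; unfold zterm; [reflexivity|].
rewrite Z.opp_involutive. ring.
Qed.

Lemma geoZ_le (f g : Z -> C) : geoZ g -> (forall j, (Cmod (f j) <= Cmod (g j))%R) -> geoZ f.
Proof.
intros [K [r [Hr H]]] Hfg. exists K, r. split; [exact Hr|].
intros n. eapply Rle_trans; [apply Hfg|apply H].
Qed.

Lemma geoZ_ext (f g : Z -> C) : geoZ f -> (forall j, g j = f j) -> geoZ g.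
Proof. intros Hf H. apply (geoZ_le g f Hf). intros n. rewrite H. apply Rle_refl. Qed.

Lemma geoZ_plus (f g : Z -> C) : geoZ f -> geoZ g -> geoZ (fun j => f j + g j).
Proof.
intros [K [r [Hr H]]] [K' [r' [Hr' H']]].
exists (K + K')%R, (Rmax r r'). split.
- unfold Rmax; destruct (Rle_dec r r'); lra.
- intros j. eapply Rle_trans; [apply Cmod_triangle|].
  pose proof (geoZ_K_ge0 _ _ _ H). pose proof (geoZ_K_ge0 _ _ _ H').
  specialize (H j). specialize (H' j). set (n := Z.abs_nat j) in *.
  assert (r ^ n <= Rmax r r' ^ n)%R by (apply pow_incr; pose proof (Rmax_l r r'); lra).
  assert (r' ^ n <= Rmax r r' ^ n)%R by (apply pow_incr; pose proof (Rmax_r r r'); lra).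
  nra.
Qed.

Lemma geoZ_scal (c : C) (f : Z -> C) : geoZ f -> geoZ (fun j => c * f j).
Proof.
intros [K [r [Hr H]]]. exists (Cmod c * K)%R, r. split; [exact Hr|].
intros j. rewrite Cmod_mult, Rmult_assoc.
apply Rmult_le_compat_l; [apply Cmod_ge_0|apply H].
Qed.

Lemma geoZ_opp_index (f : Z -> C) : geoZ f -> geoZ (fun j => f (- j)%Z).
Proof.
intros [K [r [Hr H]]]. exists K, r. split; [exact Hr|].
intros j. specialize (H (- j)%Z). replace (Z.abs_nat (- j)) with (Z.abs_nat j) in H by lia. exact H.
Qed.

Lemma geoZ_mult_linear (c f : Z -> C) (M : R) :
  (forall j, (Cmod (c j) <= M * (INR (Z.abs_nat j) + 1))%R) ->
  geoZ f -> geoZ (fun j => c j * f j).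
Proof.
intros Hc [K [r [Hr H]]].
destruct (geo_rate_absorb r Hr) as [M' [rho [Hrho HM']]].
exists (M * K * M')%R, rho. split; [exact Hrho|]. intros j.
assert (HK := geoZ_K_ge0 _ _ _ H).
specialize (Hc j). specialize (H j). specialize (HM' (Z.abs_nat j)).
assert (0 <= INR (Z.abs_nat j))%R by apply pos_INR.
pose proof (Cmod_ge_0 (c j)). pose proof (Cmod_ge_0 (f j)).
assert (HM : (0 <= M)%R) by nra.
rewrite Cmod_mult. eapply Rle_trans; [apply Rmult_le_compat; eassumption|].
replace (M * (INR (Z.abs_nat j) + 1) * (K * r ^ Z.abs_nat j))%R
  with (M * K * ((INR (Z.abs_nat j) + 1) * r ^ Z.abs_nat j))%R by ring.
rewrite (Rmult_assoc (M * K)). apply Rmult_le_compat_l; [nra|exact HM'].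
Qed.

Lemma geoZ_mult_bounded (c f : Z -> C) (M : R) :
  (forall j, (Cmod (c j) <= M)%R) -> geoZ f -> geoZ (fun j => c j * f j).
Proof.
intros Hc. apply (geoZ_mult_linear c f M). intros j.
assert (0 <= INR (Z.abs_nat j))%R by apply pos_INR.
specialize (Hc j). pose proof (Cmod_ge_0 (c j)). nra.
Qed.

Lemma geoZ_mult_linear_pow (c f : Z -> C) (M : R) (k : nat) :
  (forall j, (Cmod (c j) <= M * (INR (Z.abs_nat j) + 1))%R) ->
  geoZ f -> geoZ (fun j => c j ^ k * f j).
Proof.
intros Hc Hf. induction k as [|k IH].
- apply (geoZ_ext f _ Hf). intros j. simpl. ring.
- apply (geoZ_ext _ _ (geoZ_mult_linear _ _ _ Hc IH)). intros j. rewrite Cpow_S. ring.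
Qed.

Lemma pow_le_exponent (s : R) (a b : nat) : (0 <= s <= 1)%R -> (a <= b)%nat ->
  (s ^ b <= s ^ a)%R.
Proof.
intros Hs Hab. replace b with (a + (b - a))%nat by lia. rewrite pow_add.
assert (0 <= s ^ a)%R by (apply pow_le; lra).
assert (s ^ (b - a) <= 1)%R by (rewrite <- (pow1 (b - a)); apply pow_incr; lra).
nra.
Qed.

Lemma geoZ_shift (f : Z -> C) (d : Z) : geoZ f -> geoZ (fun j => f (j + d)%Z).
Proof.
intros [K [r [Hr H]]]. assert (HK := geoZ_K_ge0 _ _ _ H).
exists (K * / r ^ Z.abs_nat d)%R, r. split; [exact Hr|]. intros j.
eapply Rle_trans; [apply H|].
rewrite Rmult_assoc. apply Rmult_le_compat_l; [exact HK|].
assert (Hp : (0 < r ^ Z.abs_nat d)%R) by (apply pow_lt; lra).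
apply Rmult_le_reg_l with (r ^ Z.abs_nat d)%R; [exact Hp|].
rewrite <- Rmult_assoc, Rinv_r, Rmult_1_l by lra.
rewrite <- pow_add. apply pow_le_exponent; [lra|lia].
Qed.

Lemma sum_n_zterm_shift (f : Z -> C) (N : nat) :
  sum_n (zterm (fun j => f (j + 1)%Z)) N =
  sum_n (zterm f) N + (f (Z.of_nat N + 1)%Z - f (- Z.of_nat N)%Z).
Proof.
induction N as [|N IH].
- rewrite !sum_O. simpl. C_ring.
- rewrite !sum_Sn, IH. change plus with Cplus. unfold zterm.
  replace (- Z.of_nat (S N) + 1)%Z with (- Z.of_nat N)%Z by lia.
  replace (Z.of_nat N + 1)%Z with (Z.of_nat (S N)) by lia. C_ring.
Qed.

(** The symmetric partial sums of the two families differ by two boundary terms, which tend to 0. *)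
Lemma Zsum_shift1 (f : Z -> C) : geoZ f -> Zsum (fun j => f (j + 1)%Z) = Zsum f.
Proof.
intros Hf. unfold Zsum. apply CSeries_unique.
assert (Hs := geo_is_series _ (geoZ_zterm f Hf)).
destruct Hf as [K [r [Hr H]]]. assert (HK := geoZ_K_ge0 _ _ _ H).
apply is_series_C_spec. intros eps Heps.
destruct (proj1 (is_series_C_spec _ _) Hs (eps / 2)%R) as [N1 H1]; [lra|].
destruct (pow_small (2 * K) r (eps / 2) Hr) as [N2 H2]; [lra|].
exists (N1 + N2)%nat. intros n Hn.
specialize (H1 n ltac:(lia)). specialize (H2 n ltac:(lia)).
rewrite sum_n_zterm_shift.
match goal with |- (Cmod (?s + ?e - ?l) < _)%R =>
  replace (s + e - l) with ((s - l) + e) by ring end.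
eapply Rle_lt_trans; [apply Cmod_triangle|].
assert (H3 : (Cmod (f (Z.of_nat n + 1)%Z - f (- Z.of_nat n)%Z) <= 2 * K * r ^ n)%R).
{ eapply Rle_trans; [apply Cmod_triangle|]. rewrite Cmod_opp.
  pose proof (H (Z.of_nat n + 1)%Z) as Ha. pose proof (H (- Z.of_nat n)%Z) as Hb.
  replace (Z.abs_nat (Z.of_nat n + 1)) with (S n) in Ha by lia.
  replace (Z.abs_nat (- Z.of_nat n)) with n in Hb by lia.
  pose proof (pow_le_exponent r n (S n) ltac:(lra) ltac:(lia)). nra. }
lra.
Qed.

Lemma Zsum_shift (f : Z -> C) (d : Z) : geoZ f -> Zsum (fun j => f (j + d)%Z) = Zsum f.
Proof.
intros Hf. revert d.
assert (Hstep : forall d, Zsum (fun j => f (j + Z.succ d)%Z) = Zsum (fun j => f (j + d)%Z)).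
{ intros d. rewrite <- (Zsum_shift1 (fun j => f (j + d)%Z)) by now apply geoZ_shift.
  apply Zsum_ext. intros j. f_equal. lia. }
apply Z.peano_ind.
- apply Zsum_ext. intros j. f_equal. lia.
- intros d IH. now rewrite Hstep.
- intros d IH. now rewrite <- Hstep, Z.succ_pred.
Qed.

Lemma Zsum_odd (f : Z -> C) : geoZ f -> (forall j, f (- j)%Z = - f j) -> Zsum f = 0.
Proof.
intros Hf Hodd.
assert (H : Zsum f = (- (1)) * Zsum f).
{ rewrite <- Zsum_scal by exact Hf. rewrite <- (Zsum_opp_index f) at 1.
  apply Zsum_ext. intros j. rewrite Hodd. ring. }
replace (Zsum f) with ((Zsum f - (- (1)) * Zsum f) / 2) by field.
rewrite <- H. field.
Qed.

(** * Exchange of sums and skew substitution over pairs of integers *)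

Definition geo2Z (a : Z -> Z -> C) : Prop :=
  exists K r : R, (0 < r < 1)%R /\
    forall i j, (Cmod (a i j) <= K * r ^ Z.abs_nat i * r ^ Z.abs_nat j)%R.

Lemma geo2Z_intro (a : Z -> Z -> C) (f g : Z -> C) : geoZ f -> geoZ g ->
  (forall i j, (Cmod (a i j) <= Cmod (f i) * Cmod (g j))%R) -> geo2Z a.
Proof.
intros [K [r [Hr H]]] [K' [r' [Hr' H']]] Hle.
exists (K * K')%R, (Rmax r r'). split.
- unfold Rmax; destruct (Rle_dec r r'); lra.
- intros i j. eapply Rle_trans; [apply Hle|].
  pose proof (geoZ_K_ge0 _ _ _ H). pose proof (geoZ_K_ge0 _ _ _ H').
  specialize (H i). specialize (H' j).
  set (n := Z.abs_nat i) in *. set (m := Z.abs_nat j) in *.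
  assert (r ^ n <= Rmax r r' ^ n)%R by (apply pow_incr; pose proof (Rmax_l r r'); lra).
  assert (r' ^ m <= Rmax r r' ^ m)%R by (apply pow_incr; pose proof (Rmax_r r r'); lra).
  replace (K * K' * Rmax r r' ^ n * Rmax r r' ^ m)%R
    with ((K * Rmax r r' ^ n) * (K' * Rmax r r' ^ m))%R by ring.
  apply Rmult_le_compat; try apply Cmod_ge_0; nra.
Qed.

Lemma geo2Z_row (a : Z -> Z -> C) (i : Z) : geo2Z a -> geoZ (a i).
Proof. intros [K [r [Hr H]]]. exists (K * r ^ Z.abs_nat i)%R, r. split; auto. Qed.

Lemma geo2Z_flip (a : Z -> Z -> C) : geo2Z a -> geo2Z (fun i j => a j i).
Proof.
intros [K [r [Hr H]]]. exists K, r. split; [exact Hr|].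
intros i j. specialize (H j i). lra.
Qed.

Lemma geo2Z_sum (a : Z -> Z -> C) : geo2Z a -> geoZ (fun i => Zsum (a i)).
Proof.
intros [K [r [Hr H]]]. exists (2 * K / (1 - r))%R, r. split; [exact Hr|].
intros i. eapply Rle_trans.
- apply (CSeries_bound _ (2 * (K * r ^ Z.abs_nat i)) r Hr).
  intros m. apply zterm_bound. apply H.
- apply Req_le. field. lra.
Qed.

Lemma Zsum_fubini (a : Z -> Z -> C) : geo2Z a ->
  Zsum (fun i => Zsum (a i)) = Zsum (fun j => Zsum (fun i => a i j)).
Proof.
intros Ha.
transitivity (CSeries (fun n => CSeries (fun m => zterm (fun i => zterm (a i) m) n))).
- apply CSeries_ext. intros [|n]; [reflexivity|]. unfold zterm at 1, Zsum.
  rewrite <- CSeries_plus by (apply geoZ_zterm, geo2Z_row, Ha).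
  apply CSeries_ext. reflexivity.
- rewrite CSeries_fubini.
  + apply CSeries_ext. intros [|m]; [reflexivity|]. unfold zterm at 3.
    rewrite <- Zsum_plus by exact (geo2Z_row _ _ (geo2Z_flip a Ha)).
    reflexivity.
  + destruct Ha as [K [r [Hr H]]]. exists (4 * K)%R, r. split; [exact Hr|].
    intros n m.
    replace (4 * K * r ^ n * r ^ m)%R with (2 * (2 * K * r ^ m) * r ^ n)%R by ring.
    apply zterm_bound. intros i.
    replace (2 * K * r ^ m * r ^ Z.abs_nat i)%R
      with (2 * (K * r ^ Z.abs_nat i) * r ^ m)%R by ring.
    apply zterm_bound. apply H.
Qed.

(** Since 2(|n-m| + |m|) >= |n| + |m|, the bound survives with [sqrt r] in place of [r]. *)
Lemma geo2Z_skew (a : Z -> Z -> C) : geo2Z a -> geo2Z (fun n m => a (n - m)%Z m).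
Proof.
intros [K [r [Hr H]]].
assert (Hs0 : (0 < sqrt r)%R) by (apply sqrt_lt_R0; lra).
assert (Hss : (sqrt r * sqrt r = r)%R) by (apply sqrt_sqrt; lra).
assert (Hs1 : (sqrt r < 1)%R) by nra.
exists K, (sqrt r). split; [lra|]. intros n m.
assert (HK : (0 <= K)%R).
{ specialize (H 0%Z 0%Z). pose proof (Cmod_ge_0 (a 0%Z 0%Z)). simpl in H. lra. }
eapply Rle_trans; [apply H|].
rewrite !Rmult_assoc. apply Rmult_le_compat_l; [exact HK|].
rewrite <- Hss at 1 2. rewrite !Rpow_mult_distr, <- !pow_add.
apply pow_le_exponent; [lra|lia].
Qed.

(** The substitution n = j + m, which turns convolutions into double sums: after exchanging the sums
    it is a translation for each fixed m. *)
Lemma Zsum_skew (a : Z -> Z -> C) : geo2Z a ->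
  Zsum (fun n => Zsum (fun m => a (n - m)%Z m)) = Zsum (fun m => Zsum (fun j => a j m)).
Proof.
intros Ha. rewrite (Zsum_fubini _ (geo2Z_skew a Ha)).
apply Zsum_ext. intros m.
exact (Zsum_shift (fun j => a j m) (- m) (geo2Z_row _ _ (geo2Z_flip a Ha))).
Qed.

(** * Nonvanishing denominators *)

Lemma Cinv_neq0 (x : C) : x <> 0 -> / x <> 0.
Proof. intros Hx E. apply C1_nz. rewrite <- (Cinv_r x Hx), E. ring. Qed.

Lemma Cmod_one_minus_ge (x : C) : (1 - Cmod x <= Cmod (1 - x))%R.
Proof.
pose proof (Cmod_triangle (1 - x) x) as H.
replace (1 - x + x) with (RtoC 1) in H by ring. rewrite Cmod_1 in H. lra.
Qed.

Lemma one_minus_neq0 (x : C) : (Cmod x < 1)%R -> 1 - x <> 0.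
Proof.
intros Hx E. pose proof (Cmod_one_minus_ge x) as H. rewrite E, Cmod_0 in H. lra.
Qed.

Lemma one_plus_neq0 (x : C) : (Cmod x < 1)%R -> 1 + x <> 0.
Proof.
intros Hx. replace (1 + x) with (1 - - x) by ring.
apply one_minus_neq0. now rewrite Cmod_opp.
Qed.

Lemma Cmod_pow_lt1 (q : C) (n : nat) : (Cmod q < 1)%R -> (Cmod (q ^ S n) < 1)%R.
Proof.
intros Hq. rewrite Cmod_pow. pose proof (Cmod_ge_0 q). apply pow_lt_1_compat; [lra|lia].
Qed.

(** * Integer powers of [q] *)

Definition qz (q : C) (j : Z) : C :=
  match j with
  | Z0 => 1
  | Zpos p => q ^ Pos.to_nat p
  | Zneg p => / q ^ Pos.to_nat p
  end.

Lemma qz_of_nat (q : C) (n : nat) : qz q (Z.of_nat n) = q ^ n.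
Proof.
destruct n as [|n]; [reflexivity|].
simpl Z.of_nat. unfold qz. now rewrite SuccNat2Pos.id_succ.
Qed.

Lemma qz_neq0 (q : C) (j : Z) : q <> 0 -> qz q j <> 0.
Proof.
intros Hq. destruct j; simpl;
  [apply C1_nz|now apply Cpow_nz|now apply Cinv_neq0, Cpow_nz].
Qed.

Lemma qz_opp (q : C) (j : Z) : q <> 0 -> qz q (- j) = / qz q j.
Proof.
intros Hq. destruct j; simpl; [field|reflexivity|].
field. now apply Cpow_nz.
Qed.

Lemma qz_succ (q : C) (j : Z) : q <> 0 -> qz q (Z.succ j) = q * qz q j.
Proof.
intros Hq. destruct (Z_le_gt_dec 0 j) as [Hj|Hj].
- rewrite <- (Z2Nat.id j Hj), <- Nat2Z.inj_succ, !qz_of_nat. apply Cpow_S.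
- replace (Z.succ j) with (- Z.of_nat (Z.to_nat (- j) - 1))%Z by lia.
  replace j with (- Z.of_nat (S (Z.to_nat (- j) - 1)))%Z at 2 by lia.
  rewrite !qz_opp, !qz_of_nat, Cpow_S by exact Hq.
  field. split; [now apply Cpow_nz|exact Hq].
Qed.

Lemma qz_add (q : C) (i j : Z) : q <> 0 -> qz q (i + j) = qz q i * qz q j.
Proof.
intros Hq. revert i. apply Z.peano_ind.
- simpl. now rewrite Cmult_1_l.
- intros i IH. rewrite Z.add_succ_l, !qz_succ, IH by exact Hq. ring.
- intros i IH.
  assert (H : q * qz q (Z.pred i + j) = q * (qz q (Z.pred i) * qz q j)).
  { rewrite <- qz_succ, Cmult_assoc, <- qz_succ by exact Hq.
    rewrite <- Z.add_succ_l, Z.succ_pred. exact IH. }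
  apply (f_equal (Cmult (/ q))) in H. rewrite !Cmult_assoc, Cinv_l in H by exact Hq.
  rewrite !Cmult_1_l in H. now rewrite H.
Qed.

Lemma qz_nat_lt1 (q : C) (n : nat) : (Cmod q < 1)%R -> (Cmod (qz q (Z.of_nat (S n))) < 1)%R.
Proof. intros Hq. rewrite qz_of_nat. now apply Cmod_pow_lt1. Qed.

(** For negative j the modulus of q^j exceeds 1; passing to the inverse reduces the nonvanishing of
    1 + q^j and 1 - q^j to the case of modulus below 1. *)
Lemma qz_cases (q : C) (j : Z) : q <> 0 -> (Cmod q < 1)%R -> j <> 0%Z ->
  (Cmod (qz q j) < 1)%R \/ (Cmod (/ qz q j) < 1)%R.
Proof.
intros Hq0 Hq Hj. destruct (Z_lt_le_dec 0 j) as [H|H].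
- left. replace j with (Z.of_nat (S (Z.to_nat j - 1))) by lia. now apply qz_nat_lt1.
- right. rewrite <- qz_opp by exact Hq0.
  replace (- j)%Z with (Z.of_nat (S (Z.to_nat (- j) - 1))) by lia. now apply qz_nat_lt1.
Qed.

Lemma qz_one_plus_neq0 (q : C) (j : Z) : q <> 0 -> (Cmod q < 1)%R -> 1 + qz q j <> 0.
Proof.
intros Hq0 Hq. destruct (Z.eq_dec j 0) as [->|Hj].
- simpl. intros E. rewrite <- RtoC_plus in E. apply RtoC_inj in E. lra.
- assert (Hw := qz_neq0 q j Hq0).
  destruct (qz_cases q j Hq0 Hq Hj) as [H|H]; [now apply one_plus_neq0|].
  intros E. apply (one_plus_neq0 _ H).
  replace (1 + / qz q j) with (/ qz q j * (1 + qz q j)) by (field; exact Hw).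
  rewrite E. ring.
Qed.

Lemma qz_one_minus_neq0 (q : C) (j : Z) : q <> 0 -> (Cmod q < 1)%R -> j <> 0%Z ->
  1 - qz q j <> 0.
Proof.
intros Hq0 Hq Hj. assert (Hw := qz_neq0 q j Hq0).
destruct (qz_cases q j Hq0 Hq Hj) as [H|H]; [now apply one_minus_neq0|].
intros E. apply (one_minus_neq0 _ H).
replace (1 - / qz q j) with (- (/ qz q j) * (1 - qz q j)) by (field; exact Hw).
rewrite E. ring.
Qed.

(** * The functions [D^k (w / (1 + w)^2)], [D = w d/dw], at [w = q^j] *)

Definition av (q : C) (j : Z) : C := qz q j / (1 + qz q j) ^ 2.
Definition uv (q : C) (j : Z) : C := (qz q j - 1) / (1 + qz q j).

(* With [a = w / (1 + w)^2] and [u = (w - 1) / (w + 1)] one has [D a = - u a],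
   [D u = 2 a] and [u^2 = 1 - 4 a], so even derivatives of [a] are polynomials in [a]. *)
Definition D2 (a : C) : C := a * (1 - 6 * a).
Definition D4 (a : C) : C := a * (1 - 30 * a + 120 * a ^ 2).
Definition D6 (a : C) : C := a * (1 - 126 * a + 1680 * a ^ 2 - 5040 * a ^ 3).
Definition D1 (u a : C) : C := - (u * a).
Definition D3 (u a : C) : C := - (u * (a * (1 - 12 * a))).

(* Kernels of the partial fraction expansion of [a(w) a(c w)], [c = q^d]. *)
Definition csigma (q : C) (d : Z) : C :=
  if Z.eqb d 0 then 0 else qz q d / (1 - qz q d) ^ 2.
Definition gam (q : C) (d : Z) : C :=
  if Z.eqb d 0 then 0 else qz q d * (1 + qz q d) / (1 - qz q d) ^ 3.
Definition delta (d : Z) : C := if Z.eqb d 0 then 1 else 0.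

(** This is D^2, with c = x/w held constant, of a(w) a(cw) = - c/(1-c)^2 (a(w) + a(cw)) +
    c(1+c)/(1-c)^3 (w/(1+w) - cw/(1+cw)). The left side is the Leibniz rule; on the right [D1]
    occurs next to [D2] because D (w/(1+w)) = a(w). *)
Lemma partial_fraction_D2 (w x : C) : w <> 0 -> 1 + w <> 0 -> 1 + x <> 0 -> w - x <> 0 ->
  let a := w / (1 + w) ^ 2 in let u := (w - 1) / (1 + w) in
  let a' := x / (1 + x) ^ 2 in let u' := (x - 1) / (1 + x) in
  let c := x / w in
  a * D2 a' + D2 a * a' + 2 * (D1 u a * D1 u' a') =
  - (c / (1 - c) ^ 2) * (D2 a + D2 a')
  + c * (1 + c) / (1 - c) ^ 3 * (D1 u a - D1 u' a').
Proof.
intros Hw Hw1 Hx1 Hwx. cbv zeta. unfold D2, D1. field. repeat split; try assumption.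
Qed.

(** D^4 of the same identity; 1, 4, 6, 4, 1 are the Leibniz coefficients. *)
Lemma partial_fraction_D4 (w x : C) : w <> 0 -> 1 + w <> 0 -> 1 + x <> 0 -> w - x <> 0 ->
  let a := w / (1 + w) ^ 2 in let u := (w - 1) / (1 + w) in
  let a' := x / (1 + x) ^ 2 in let u' := (x - 1) / (1 + x) in
  let c := x / w in
  a * D4 a' + D4 a * a' + 4 * (D1 u a * D3 u' a') + 4 * (D3 u a * D1 u' a')
  + 6 * (D2 a * D2 a') =
  - (c / (1 - c) ^ 2) * (D4 a + D4 a')
  + c * (1 + c) / (1 - c) ^ 3 * (D3 u a - D3 u' a').
Proof.
intros Hw Hw1 Hx1 Hwx. cbv zeta. unfold D4, D3, D2, D1. field.
repeat split; try assumption.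
Qed.

Lemma Cmod_div_bound (x y : C) (X m : R) : (0 < m)%R -> (Cmod x <= X)%R ->
  (m <= Cmod y)%R -> (Cmod (x / y) <= X / m)%R.
Proof.
intros Hm Hx Hy.
assert (Hy0 : y <> 0) by (apply Cmod_gt_0; lra).
rewrite Cmod_div by exact Hy0.
pose proof (Cmod_ge_0 x). unfold Rdiv. apply Rmult_le_compat; [lra| |lra|].
- left. apply Rinv_0_lt_compat. lra.
- apply Rinv_le_contravar; lra.
Qed.

Lemma Cmod_one_plus_ge (x : C) : (1 - Cmod x <= Cmod (1 + x))%R.
Proof.
replace (1 + x) with (1 - - x) by ring.
rewrite <- (Cmod_opp x). apply Cmod_one_minus_ge.
Qed.

(** The last bound starts at exponent 1 because 1 - q^0 = 0, whereas 1 + q^0 = 2 is harmless. *)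
Lemma qz_nat_bounds (q : C) (n : nat) : (Cmod q < 1)%R ->
  (Cmod (q ^ n) <= 1)%R /\ (1 - Cmod q <= Cmod (1 + q ^ n))%R /\
  (1 - Cmod q <= Cmod (1 - q ^ S n))%R.
Proof.
intros Hq. pose proof (Cmod_ge_0 q) as H0.
assert (H1 : (Cmod (q ^ n) <= 1)%R)
  by (rewrite Cmod_pow, <- (pow1 n); apply pow_incr; lra).
assert (H2 : (Cmod (q ^ S n) <= Cmod q)%R)
  by (rewrite Cpow_S, Cmod_mult; pose proof (Cmod_ge_0 (q ^ n)); nra).
split; [exact H1|]. split.
- destruct n as [|n].
  + simpl. rewrite <- RtoC_plus, Cmod_R, Rabs_pos_eq; lra.
  + eapply Rle_trans; [|apply Cmod_one_plus_ge].
    assert (H3 : (Cmod (q ^ S n) <= Cmod q)%R); [|lra].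
    rewrite Cpow_S, Cmod_mult. rewrite Cpow_S, !Cmod_mult in H1.
    assert (Cmod (q ^ n) <= 1)%R
      by (rewrite Cmod_pow, <- (pow1 n); apply pow_incr; lra).
    nra.
- eapply Rle_trans; [|apply Cmod_one_minus_ge]. lra.
Qed.

Lemma geoZ_of_nat (f : Z -> C) (K r : R) : (0 < r < 1)%R ->
  (forall j, Cmod (f (- j)%Z) = Cmod (f j)) ->
  (forall n, (Cmod (f (Z.of_nat n)) <= K * r ^ n)%R) -> geoZ f.
Proof.
intros Hr Hsym H. exists K, r. split; [exact Hr|]. intros j.
destruct (Z_le_gt_dec 0 j) as [Hj|Hj].
- replace j with (Z.of_nat (Z.abs_nat j)) at 1 by lia. apply H.
- rewrite <- Hsym. replace (- j)%Z with (Z.of_nat (Z.abs_nat j)) by lia. apply H.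
Qed.

Lemma av_even (q : C) (j : Z) : q <> 0 -> (Cmod q < 1)%R -> av q (- j) = av q j.
Proof.
intros Hq0 Hq. unfold av. rewrite qz_opp by exact Hq0.
pose proof (qz_neq0 q j Hq0). pose proof (qz_one_plus_neq0 q j Hq0 Hq).
field. repeat split; try assumption; now rewrite Cplus_comm.
Qed.

Lemma uv_odd (q : C) (j : Z) : q <> 0 -> (Cmod q < 1)%R -> uv q (- j) = - uv q j.
Proof.
intros Hq0 Hq. unfold uv. rewrite qz_opp by exact Hq0.
pose proof (qz_neq0 q j Hq0). pose proof (qz_one_plus_neq0 q j Hq0 Hq).
field. repeat split; try assumption; now rewrite Cplus_comm.
Qed.

Lemma sigma_even (q : C) (j : Z) : q <> 0 -> (Cmod q < 1)%R -> csigma q (- j) = csigma q j.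
Proof.
intros Hq0 Hq. unfold csigma. rewrite qz_opp by exact Hq0.
destruct (Z.eqb_spec j 0) as [->|Hj]; [reflexivity|].
replace (Z.eqb (- j) 0) with false by (symmetry; apply Z.eqb_neq; lia).
pose proof (qz_neq0 q j Hq0). pose proof (qz_one_minus_neq0 q j Hq0 Hq Hj).
field. repeat split; try assumption.
intros E. apply H0. replace (1 - qz q j) with (- (qz q j - 1)) by ring. rewrite E. ring.
Qed.

Lemma gam_odd (q : C) (j : Z) : q <> 0 -> (Cmod q < 1)%R -> gam q (- j) = - gam q j.
Proof.
intros Hq0 Hq. unfold gam. rewrite qz_opp by exact Hq0.
destruct (Z.eqb_spec j 0) as [->|Hj]; [simpl; ring|].
replace (Z.eqb (- j) 0) with false by (symmetry; apply Z.eqb_neq; lia).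
pose proof (qz_neq0 q j Hq0). pose proof (qz_one_minus_neq0 q j Hq0 Hq Hj).
field. repeat split; try assumption.
intros E. apply H0. replace (1 - qz q j) with (- (qz q j - 1)) by ring. rewrite E. ring.
Qed.

Lemma geoZ_rational (q : C) (f : Z -> C) (M : R) : q <> 0 -> (Cmod q < 1)%R ->
  (forall j, Cmod (f (- j)%Z) = Cmod (f j)) ->
  (forall n, (Cmod (f (Z.of_nat n)) <= M * Cmod (q ^ n))%R) -> geoZ f.
Proof.
intros Hq0 Hq Hsym H. apply (geoZ_of_nat f M (Cmod q)); [|exact Hsym|].
- split; [now apply Cmod_gt_0|exact Hq].
- intros n. rewrite <- Cmod_pow. apply H.
Qed.

Lemma geoZ_av (q : C) : q <> 0 -> (Cmod q < 1)%R -> geoZ (av q).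
Proof.
intros Hq0 Hq. apply (geoZ_rational q _ (/ (1 - Cmod q) ^ 2) Hq0 Hq).
- intros j. now rewrite av_even.
- intros n. unfold av. rewrite qz_of_nat.
  destruct (qz_nat_bounds q n Hq) as [_ [H _]].
  rewrite Rmult_comm. apply Cmod_div_bound; [apply pow_lt; lra|apply Rle_refl|].
  rewrite Cmod_pow. apply pow_incr. lra.
Qed.

Lemma geoZ_sigma (q : C) : q <> 0 -> (Cmod q < 1)%R -> geoZ (csigma q).
Proof.
intros Hq0 Hq. apply (geoZ_rational q _ (/ (1 - Cmod q) ^ 2) Hq0 Hq).
- intros j. now rewrite sigma_even.
- intros [|n]; unfold csigma.
  + simpl. rewrite Cmod_0. apply Rmult_le_pos; [|apply Cmod_ge_0].
    left. apply Rinv_0_lt_compat. apply (pow_lt _ 2). lra.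
  + rewrite qz_of_nat. replace (Z.eqb _ 0) with false by (symmetry; apply Z.eqb_neq; lia).
    destruct (qz_nat_bounds q n Hq) as [_ [_ H]].
    rewrite Rmult_comm. apply Cmod_div_bound; [apply pow_lt; lra|apply Rle_refl|].
    rewrite Cmod_pow. apply pow_incr. lra.
Qed.

Lemma geoZ_gam (q : C) : q <> 0 -> (Cmod q < 1)%R -> geoZ (gam q).
Proof.
intros Hq0 Hq. apply (geoZ_rational q _ (2 / (1 - Cmod q) ^ 3) Hq0 Hq).
- intros j. now rewrite gam_odd, Cmod_opp.
- intros [|n]; unfold gam.
  + simpl. rewrite Cmod_0. apply Rmult_le_pos; [|apply Cmod_ge_0].
    apply Rdiv_le_0_compat; [lra|]. apply (pow_lt _ 3). lra.
  + rewrite qz_of_nat. replace (Z.eqb _ 0) with false by (symmetry; apply Z.eqb_neq; lia).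
    destruct (qz_nat_bounds q n Hq) as [_ [_ H]].
    destruct (qz_nat_bounds q (S n) Hq) as [H1 _].
    replace (2 / (1 - Cmod q) ^ 3 * Cmod (q ^ S n))%R
      with ((Cmod (q ^ S n) * 2) / (1 - Cmod q) ^ 3)%R by (unfold Rdiv; ring).
    apply Cmod_div_bound; [apply pow_lt; lra| |].
    * rewrite Cmod_mult. apply Rmult_le_compat_l; [apply Cmod_ge_0|].
      eapply Rle_trans; [apply Cmod_triangle|]. rewrite Cmod_1. lra.
    * rewrite Cmod_pow. apply pow_incr. lra.
Qed.

Lemma geoZ_delta : geoZ delta.
Proof.
apply (geoZ_of_nat _ 1 (/ 2)); [lra| |].
- intros [|p|p]; reflexivity.
- intros [|n]; unfold delta; simpl.
  + rewrite Cmod_1. lra.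
  + rewrite Cmod_0. assert (0 < (/ 2) ^ n)%R by (apply pow_lt; lra). lra.
Qed.

Lemma uv_bounded (q : C) : q <> 0 -> (Cmod q < 1)%R ->
  forall j, (Cmod (uv q j) <= 2 / (1 - Cmod q))%R.
Proof.
intros Hq0 Hq.
assert (H : forall n, (Cmod (uv q (Z.of_nat n)) <= 2 / (1 - Cmod q))%R).
{ intros n. unfold uv. rewrite qz_of_nat.
  destruct (qz_nat_bounds q n Hq) as [H1 [H2 _]].
  apply Cmod_div_bound; [lra| |exact H2].
  eapply Rle_trans; [apply Cmod_triangle|]. rewrite Cmod_opp, Cmod_1. lra. }
intros j. destruct (Z_le_gt_dec 0 j) as [Hj|Hj].
- replace j with (Z.of_nat (Z.to_nat j)) by lia. apply H.
- rewrite <- (Z.opp_involutive j), uv_odd, Cmod_opp by assumption.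
  replace (- j)%Z with (Z.of_nat (Z.to_nat (- j))) by lia. apply H.
Qed.

Lemma geoZ_bounded (f : Z -> C) : geoZ f -> exists M, forall j, (Cmod (f j) <= M)%R.
Proof.
intros [K [r [Hr H]]]. assert (HK := geoZ_K_ge0 _ _ _ H). exists K. intros j.
eapply Rle_trans; [apply H|].
assert (r ^ Z.abs_nat j <= 1)%R by (rewrite <- (pow1 (Z.abs_nat j)); apply pow_incr; lra).
nra.
Qed.

Lemma geoZ_mult (f g : Z -> C) : geoZ f -> geoZ g -> geoZ (fun j => f j * g j).
Proof.
intros Hf Hg. destruct (geoZ_bounded f Hf) as [M HM].
exact (geoZ_mult_bounded f g M HM Hg).
Qed.

Lemma geoZ_cubic (f : Z -> C) (c1 c2 c3 : C) : geoZ f ->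
  geoZ (fun j => f j * (1 + c1 * f j + c2 * f j ^ 2 + c3 * f j ^ 3)).
Proof.
intros Hf. assert (H2 := geoZ_mult f f Hf Hf). assert (H3 := geoZ_mult f _ Hf H2).
assert (H4 := geoZ_mult f _ Hf H3). cbv beta in *.
apply (geoZ_ext _ _ (geoZ_plus _ _ (geoZ_plus _ _ Hf (geoZ_scal c1 _ H2))
  (geoZ_plus _ _ (geoZ_scal c2 _ H3) (geoZ_scal c3 _ H4)))).
intros j. ring.
Qed.

Lemma geoZ_D2 (f : Z -> C) : geoZ f -> geoZ (fun j => D2 (f j)).
Proof.
intros Hf. apply (geoZ_ext _ _ (geoZ_cubic f (- (6)) 0 0 Hf)). intros j. unfold D2. ring.
Qed.

Lemma geoZ_D4 (f : Z -> C) : geoZ f -> geoZ (fun j => D4 (f j)).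
Proof.
intros Hf. apply (geoZ_ext _ _ (geoZ_cubic f (- (30)) 120 0 Hf)).
intros j. unfold D4. ring.
Qed.

Lemma geoZ_D6 (f : Z -> C) : geoZ f -> geoZ (fun j => D6 (f j)).
Proof.
intros Hf. apply (geoZ_ext _ _ (geoZ_cubic f (- (126)) 1680 (- (5040)) Hf)).
intros j. unfold D6. ring.
Qed.

Lemma geoZ_D1 (u f : Z -> C) (M : R) : (forall j, (Cmod (u j) <= M)%R) -> geoZ f ->
  geoZ (fun j => D1 (u j) (f j)).
Proof.
intros Hu Hf. apply (geoZ_ext _ _ (geoZ_scal (- (1)) _ (geoZ_mult_bounded u f M Hu Hf))).
intros j. unfold D1. ring.
Qed.

Lemma geoZ_D3 (u f : Z -> C) (M : R) : (forall j, (Cmod (u j) <= M)%R) -> geoZ f ->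
  geoZ (fun j => D3 (u j) (f j)).
Proof.
intros Hu Hf.
apply (geoZ_ext _ _ (geoZ_scal (- (1)) _
  (geoZ_mult_bounded u _ M Hu (geoZ_cubic f (- (12)) 0 0 Hf)))).
intros j. unfold D3. ring.
Qed.

(** * Double sums over [Z x Z] *)

Definition Zsum2 (F : Z -> Z -> C) : C := Zsum (fun i => Zsum (F i)).

Lemma geo2Z_ext (F G : Z -> Z -> C) : geo2Z F -> (forall i j, G i j = F i j) -> geo2Z G.
Proof.
intros [K [r [Hr H]]] HG. exists K, r. split; [exact Hr|]. intros i j. rewrite HG. apply H.
Qed.

Lemma Zsum2_ext (F G : Z -> Z -> C) : (forall i j, F i j = G i j) -> Zsum2 F = Zsum2 G.
Proof. intros H. apply Zsum_ext. intros i. apply Zsum_ext. apply H. Qed.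

Lemma geo2Z_plus (F G : Z -> Z -> C) : geo2Z F -> geo2Z G ->
  geo2Z (fun i j => F i j + G i j).
Proof.
intros [K [r [Hr H]]] [K' [r' [Hr' H']]].
assert (HK : (0 <= K)%R).
{ specialize (H 0%Z 0%Z). pose proof (Cmod_ge_0 (F 0%Z 0%Z)). simpl in H. lra. }
assert (HK' : (0 <= K')%R).
{ specialize (H' 0%Z 0%Z). pose proof (Cmod_ge_0 (G 0%Z 0%Z)). simpl in H'. lra. }
exists (K + K')%R, (Rmax r r'). split.
- unfold Rmax; destruct (Rle_dec r r'); lra.
- intros i j. eapply Rle_trans; [apply Cmod_triangle|].
  specialize (H i j). specialize (H' i j).
  rewrite Rmult_assoc, <- pow_add in H, H'. rewrite Rmult_assoc, <- pow_add.
  set (n := (Z.abs_nat i + Z.abs_nat j)%nat) in *.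
  assert (r ^ n <= Rmax r r' ^ n)%R by (apply pow_incr; pose proof (Rmax_l r r'); lra).
  assert (r' ^ n <= Rmax r r' ^ n)%R by (apply pow_incr; pose proof (Rmax_r r r'); lra).
  nra.
Qed.

Lemma geo2Z_scal (c : C) (F : Z -> Z -> C) : geo2Z F -> geo2Z (fun i j => c * F i j).
Proof.
intros [K [r [Hr H]]]. exists (Cmod c * K)%R, r. split; [exact Hr|].
intros i j. rewrite Cmod_mult, !Rmult_assoc.
apply Rmult_le_compat_l; [apply Cmod_ge_0|]. rewrite <- Rmult_assoc. apply H.
Qed.

Lemma Zsum2_plus (F G : Z -> Z -> C) : geo2Z F -> geo2Z G ->
  Zsum2 (fun i j => F i j + G i j) = Zsum2 F + Zsum2 G.
Proof.
intros HF HG. unfold Zsum2. rewrite <- Zsum_plus by now apply geo2Z_sum.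
apply Zsum_ext. intros i. apply Zsum_plus; now apply geo2Z_row.
Qed.

Lemma Zsum2_scal (c : C) (F : Z -> Z -> C) : geo2Z F ->
  Zsum2 (fun i j => c * F i j) = c * Zsum2 F.
Proof.
intros HF. unfold Zsum2. rewrite <- Zsum_scal by now apply geo2Z_sum.
apply Zsum_ext. intros i. apply Zsum_scal; now apply geo2Z_row.
Qed.

Lemma geo2Z_prod (f g : Z -> C) : geoZ f -> geoZ g -> geo2Z (fun i j => f i * g j).
Proof.
intros Hf Hg. apply (geo2Z_intro _ f g Hf Hg). intros i j. rewrite Cmod_mult. apply Rle_refl.
Qed.

Lemma Zsum2_prod (f g : Z -> C) : geoZ f -> geoZ g ->
  Zsum2 (fun i j => f i * g j) = Zsum f * Zsum g.
Proof.
intros Hf Hg. rewrite (Cmult_comm (Zsum f)), <- Zsum_scal by exact Hf.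
apply Zsum_ext. intros i. rewrite Zsum_scal by exact Hg. ring.
Qed.

Lemma geo2Z_conv_r (k f : Z -> C) : geoZ k -> geoZ f -> geo2Z (fun i j => k (j - i)%Z * f j).
Proof.
intros Hk Hf.
apply (geo2Z_ext _ _ (geo2Z_skew _ (geo2Z_prod _ f (geoZ_opp_index k Hk) Hf))).
intros i j. do 2 f_equal. lia.
Qed.

Lemma geo2Z_conv_l (k f : Z -> C) : geoZ k -> geoZ f -> geo2Z (fun i j => k (j - i)%Z * f i).
Proof. intros Hk Hf. exact (geo2Z_flip _ (geo2Z_skew _ (geo2Z_prod k f Hk Hf))). Qed.

(** In the variables j - i and j the summand is a product; reflecting [k] corrects the sign of the
    difference. *)
Lemma Zsum2_conv_r (k f : Z -> C) : geoZ k -> geoZ f ->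
  Zsum2 (fun i j => k (j - i)%Z * f j) = Zsum k * Zsum f.
Proof.
intros Hk Hf. pose proof (geo2Z_prod _ f (geoZ_opp_index k Hk) Hf) as H.
rewrite <- (Zsum_opp_index k), <- Zsum2_prod by (auto using geoZ_opp_index).
unfold Zsum2 at 2. rewrite (Zsum_fubini _ H), <- (Zsum_skew _ H).
apply Zsum2_ext. intros i j. do 2 f_equal. lia.
Qed.

Lemma Zsum2_conv_l (k f : Z -> C) : geoZ k -> geoZ f ->
  Zsum2 (fun i j => k (j - i)%Z * f i) = Zsum k * Zsum f.
Proof.
intros Hk Hf. unfold Zsum2. rewrite (Zsum_fubini _ (geo2Z_conv_l k f Hk Hf)).
rewrite <- Zsum2_prod by assumption. unfold Zsum2. rewrite (Zsum_fubini _ (geo2Z_prod k f Hk Hf)).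
exact (Zsum_skew _ (geo2Z_prod k f Hk Hf)).
Qed.

(** * The differentiated equation for g at z = 1 *)

Lemma qz_diff (q : C) (i j : Z) : q <> 0 -> qz q (j - i) = qz q j / qz q i.
Proof.
intros Hq0. replace (j - i)%Z with (j + - i)%Z by lia.
rewrite qz_add, qz_opp by exact Hq0. reflexivity.
Qed.

Lemma qz_inj (q : C) (i j : Z) : q <> 0 -> (Cmod q < 1)%R -> i <> j -> qz q i - qz q j <> 0.
Proof.
intros Hq0 Hq Hij E. apply (qz_one_minus_neq0 q (j - i) Hq0 Hq); [lia|].
assert (Hi := qz_neq0 q i Hq0). rewrite qz_diff by exact Hq0.
replace (1 - qz q j / qz q i) with ((qz q i - qz q j) / qz q i) by (field; exact Hi).
rewrite E. unfold Cdiv. ring.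
Qed.

Lemma uv_sqr (q : C) (j : Z) : q <> 0 -> (Cmod q < 1)%R -> uv q j * uv q j = 1 - 4 * av q j.
Proof.
intros Hq0 Hq. unfold uv, av. field. now apply qz_one_plus_neq0.
Qed.

Lemma sigma_gam_delta_off (q : C) (d : Z) : d <> 0%Z ->
  csigma q d = qz q d / (1 - qz q d) ^ 2 /\
  gam q d = qz q d * (1 + qz q d) / (1 - qz q d) ^ 3 /\ delta d = 0.
Proof.
intros Hd. unfold csigma, gam, delta. apply Z.eqb_neq in Hd. now rewrite Hd.
Qed.

(** Off the diagonal this is [partial_fraction_D2] with w = q^i and c = q^(j-i). On the diagonal c =
    1 is a pole of the kernels, which are set to 0 there, and [delta] supplies the value: a^2 = (a -
    D^2 a)/6, so D^2 (a^2) = (D^2 a - D^4 a)/6. *)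
Lemma pair_D2 (q : C) (i j : Z) : q <> 0 -> (Cmod q < 1)%R ->
  av q i * D2 (av q j) + D2 (av q i) * av q j
  + 2 * (D1 (uv q i) (av q i) * D1 (uv q j) (av q j)) =
  - (1) * (csigma q (j - i) * D2 (av q i)) + - (1) * (csigma q (j - i) * D2 (av q j))
  + gam q (j - i) * D1 (uv q i) (av q i) + - (1) * (gam q (j - i) * D1 (uv q j) (av q j))
  + delta (j - i) * (/ 6 * D2 (av q i) + - / 6 * D4 (av q i)).
Proof.
intros Hq0 Hq. destruct (Z.eq_dec i j) as [<-|Hij].
- rewrite Z.sub_diag. unfold csigma, gam, delta. simpl Z.eqb. cbv iota.
  pose proof (uv_sqr q i Hq0 Hq) as Hu. unfold D2, D4, D1.
  replace (- (uv q i * av q i) * - (uv q i * av q i))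
    with (uv q i * uv q i * av q i ^ 2) by ring.
  rewrite Hu. field.
- destruct (sigma_gam_delta_off q (j - i)) as [-> [-> ->]]; [lia|].
  rewrite !qz_diff by exact Hq0.
  assert (H := partial_fraction_D2 (qz q i) (qz q j) (qz_neq0 q i Hq0)
    (qz_one_plus_neq0 q i Hq0 Hq) (qz_one_plus_neq0 q j Hq0 Hq) (qz_inj q i j Hq0 Hq Hij)).
  cbv zeta in H. fold (av q i) (av q j) (uv q i) (uv q j) in H. rewrite H. ring.
Qed.

Lemma pair_D4 (q : C) (i j : Z) : q <> 0 -> (Cmod q < 1)%R ->
  av q i * D4 (av q j) + D4 (av q i) * av q j
  + 4 * (D1 (uv q i) (av q i) * D3 (uv q j) (av q j))
  + 4 * (D3 (uv q i) (av q i) * D1 (uv q j) (av q j))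
  + 6 * (D2 (av q i) * D2 (av q j)) =
  - (1) * (csigma q (j - i) * D4 (av q i)) + - (1) * (csigma q (j - i) * D4 (av q j))
  + gam q (j - i) * D3 (uv q i) (av q i) + - (1) * (gam q (j - i) * D3 (uv q j) (av q j))
  + delta (j - i) * (/ 6 * D4 (av q i) + - / 6 * D6 (av q i)).
Proof.
intros Hq0 Hq. destruct (Z.eq_dec i j) as [<-|Hij].
- rewrite Z.sub_diag. unfold csigma, gam, delta. simpl Z.eqb. cbv iota.
  pose proof (uv_sqr q i Hq0 Hq) as Hu. unfold D2, D4, D6, D3, D1.
  replace (- (uv q i * av q i) * - (uv q i * (av q i * (1 - 12 * av q i))))
    with (uv q i * uv q i * (av q i ^ 2 * (1 - 12 * av q i))) by ring.
  replace (- (uv q i * (av q i * (1 - 12 * av q i))) * - (uv q i * av q i))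
    with (uv q i * uv q i * (av q i ^ 2 * (1 - 12 * av q i))) by ring.
  rewrite Hu. field.
- destruct (sigma_gam_delta_off q (j - i)) as [-> [-> ->]]; [lia|].
  rewrite !qz_diff by exact Hq0.
  assert (H := partial_fraction_D4 (qz q i) (qz q j) (qz_neq0 q i Hq0)
    (qz_one_plus_neq0 q i Hq0 Hq) (qz_one_plus_neq0 q j Hq0 Hq) (qz_inj q i j Hq0 Hq Hij)).
  cbv zeta in H. fold (av q i) (av q j) (uv q i) (uv q j) in H. rewrite H. ring.
Qed.

Lemma Zsum_delta : Zsum delta = 1.
Proof.
unfold Zsum. rewrite CSeries_S by apply geoZ_zterm, geoZ_delta.
rewrite (CSeries_ext _ (fun n => 0 * zterm delta n)).
- rewrite CSeries_scal by apply geoZ_zterm, geoZ_delta. unfold zterm, delta. simpl. ring.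
- intros n. unfold zterm, delta. simpl. ring.
Qed.

(** Every term is a convolution, hence a product of a kernel sum and a simple sum. The two terms in
    [s] coincide, and those in [k] vanish with the sum of [k], which will be the odd kernel
    [gam]. *)
Lemma Zsum2_kernel (k s d b o e : Z -> C) : geoZ s -> geoZ k -> geoZ d ->
  geoZ b -> geoZ o -> geoZ e -> Zsum k = 0 -> Zsum d = 1 ->
  Zsum2 (fun i j => - (1) * (s (j - i)%Z * b i) + - (1) * (s (j - i)%Z * b j)
    + k (j - i)%Z * o i + - (1) * (k (j - i)%Z * o j) + d (j - i)%Z * e i) =
  - (2) * (Zsum s * Zsum b) + Zsum e.
Proof.
intros Hs Hk Hd Hb Ho He Hk0 Hd1.
assert (H1 := geo2Z_conv_l s b Hs Hb). assert (H2 := geo2Z_conv_r s b Hs Hb).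
assert (H3 := geo2Z_conv_l k o Hk Ho). assert (H4 := geo2Z_conv_r k o Hk Ho).
assert (H5 := geo2Z_conv_l d e Hd He).
assert (H1' := geo2Z_scal (- (1)) _ H1). assert (H2' := geo2Z_scal (- (1)) _ H2).
assert (H4' := geo2Z_scal (- (1)) _ H4). cbv beta in *.
assert (H12 := geo2Z_plus _ _ H1' H2'). assert (H123 := geo2Z_plus _ _ H12 H3).
assert (H1234 := geo2Z_plus _ _ H123 H4'). cbv beta in *.
rewrite (Zsum2_plus _ _ H1234 H5), (Zsum2_plus _ _ H123 H4'), (Zsum2_plus _ _ H12 H3).
rewrite (Zsum2_plus _ _ H1' H2'), (Zsum2_scal _ _ H1), (Zsum2_scal _ _ H2), (Zsum2_scal _ _ H4).
rewrite !Zsum2_conv_l, !Zsum2_conv_r by assumption. rewrite Hk0, Hd1. ring.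
Qed.

Definition G0 (q : C) : C := Zsum (av q).
Definition G2 (q : C) : C := Zsum (fun j => D2 (av q j)).
Definition G4 (q : C) : C := Zsum (fun j => D4 (av q j)).
Definition G6 (q : C) : C := Zsum (fun j => D6 (av q j)).

Lemma Zsum_gam (q : C) : q <> 0 -> (Cmod q < 1)%R -> Zsum (gam q) = 0.
Proof.
intros Hq0 Hq. apply Zsum_odd; [now apply geoZ_gam|]. intros j. now apply gam_odd.
Qed.

Lemma Zsum_D1 (q : C) : q <> 0 -> (Cmod q < 1)%R ->
  geoZ (fun j => D1 (uv q j) (av q j)) /\ Zsum (fun j => D1 (uv q j) (av q j)) = 0.
Proof.
intros Hq0 Hq.
assert (H := geoZ_D1 _ _ _ (uv_bounded q Hq0 Hq) (geoZ_av q Hq0 Hq)). split; [exact H|].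
apply Zsum_odd; [exact H|]. intros j. rewrite uv_odd, av_even by assumption. unfold D1. ring.
Qed.

Lemma Zsum_D3 (q : C) : q <> 0 -> (Cmod q < 1)%R ->
  geoZ (fun j => D3 (uv q j) (av q j)) /\ Zsum (fun j => D3 (uv q j) (av q j)) = 0.
Proof.
intros Hq0 Hq.
assert (H := geoZ_D3 _ _ _ (uv_bounded q Hq0 Hq) (geoZ_av q Hq0 Hq)). split; [exact H|].
apply Zsum_odd; [exact H|]. intros j. rewrite uv_odd, av_even by assumption. unfold D3. ring.
Qed.

(** D^2 (g^2) at z = 1 is computed twice. The Leibniz rule gives 2 g D^2 g, since D g is an odd sum
    there and vanishes; the pair identity gives -2 s D^2 g + (D^2 g - D^4 g)/6, with s the sum of
    [csigma]. *)
Lemma G4_relation (q : C) : q <> 0 -> (Cmod q < 1)%R ->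
  G4 q = (1 - 12 * Zsum (csigma q) - 12 * G0 q) * G2 q.
Proof.
intros Hq0 Hq.
assert (Ha := geoZ_av q Hq0 Hq). assert (Hb := geoZ_D2 _ Ha). assert (Hc := geoZ_D4 _ Ha).
destruct (Zsum_D1 q Hq0 Hq) as [Ho Ho0].
pose proof (Zsum2_ext _ _ (fun i j => pair_D2 q i j Hq0 Hq)) as H.
rewrite (Zsum2_kernel (gam q) (csigma q) delta) in H;
  [|now apply geoZ_sigma|now apply geoZ_gam|apply geoZ_delta|exact Hb|exact Ho
   |now apply geoZ_plus; apply geoZ_scal|now apply Zsum_gam|apply Zsum_delta].
rewrite Zsum_plus, !Zsum_scal in H by (try apply geoZ_scal; assumption).
assert (H1 := geo2Z_prod _ _ Ha Hb). assert (H2 := geo2Z_prod _ _ Hb Ha).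
assert (H3 := geo2Z_prod _ _ Ho Ho). assert (H3' := geo2Z_scal 2 _ H3).
assert (H12 := geo2Z_plus _ _ H1 H2). cbv beta in *.
rewrite (Zsum2_plus _ _ H12 H3'), (Zsum2_plus _ _ H1 H2), (Zsum2_scal _ _ H3) in H.
rewrite !Zsum2_prod, Ho0 in H by assumption.
fold (G0 q) (G2 q) (G4 q) in H.
replace (G4 q) with (6 * (- (2) * (Zsum (csigma q) * G2 q) + (/ 6 * G2 q))
  - 6 * (- (2) * (Zsum (csigma q) * G2 q) + (/ 6 * G2 q + - / 6 * G4 q))) by field.
rewrite <- H. field.
Qed.

(** Likewise for D^4 (g^2) = 2 g D^4 g + 6 (D^2 g)^2 at z = 1; clearing the denominator 6 produces
    the 36. *)
Lemma G6_relation (q : C) : q <> 0 -> (Cmod q < 1)%R ->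
  G6 q = (1 - 12 * Zsum (csigma q) - 12 * G0 q) * G4 q - 36 * G2 q ^ 2.
Proof.
intros Hq0 Hq.
assert (Ha := geoZ_av q Hq0 Hq). assert (Hb := geoZ_D2 _ Ha). assert (Hc := geoZ_D4 _ Ha).
assert (Hd := geoZ_D6 _ Ha).
destruct (Zsum_D1 q Hq0 Hq) as [Ho Ho0]. destruct (Zsum_D3 q Hq0 Hq) as [Hr Hr0].
pose proof (Zsum2_ext _ _ (fun i j => pair_D4 q i j Hq0 Hq)) as H.
rewrite (Zsum2_kernel (gam q) (csigma q) delta) in H;
  [|now apply geoZ_sigma|now apply geoZ_gam|apply geoZ_delta|exact Hc|exact Hr
   |now apply geoZ_plus; apply geoZ_scal|now apply Zsum_gam|apply Zsum_delta].
rewrite Zsum_plus, !Zsum_scal in H by (try apply geoZ_scal; assumption).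
assert (H1 := geo2Z_prod _ _ Ha Hc). assert (H2 := geo2Z_prod _ _ Hc Ha).
assert (H3 := geo2Z_prod _ _ Ho Hr). assert (H3' := geo2Z_scal 4 _ H3).
assert (H4 := geo2Z_prod _ _ Hr Ho). assert (H4' := geo2Z_scal 4 _ H4).
assert (H5 := geo2Z_prod _ _ Hb Hb). assert (H5' := geo2Z_scal 6 _ H5).
assert (H12 := geo2Z_plus _ _ H1 H2). cbv beta in *.
assert (H123 := geo2Z_plus _ _ H12 H3'). assert (H1234 := geo2Z_plus _ _ H123 H4').
cbv beta in *.
rewrite (Zsum2_plus _ _ H1234 H5'), (Zsum2_plus _ _ H123 H4'), (Zsum2_plus _ _ H12 H3'),
  (Zsum2_plus _ _ H1 H2), (Zsum2_scal _ _ H3), (Zsum2_scal _ _ H4), (Zsum2_scal _ _ H5) in H.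
rewrite !Zsum2_prod, Ho0, Hr0 in H by assumption.
fold (G0 q) (G2 q) (G4 q) (G6 q) in H.
replace (G6 q) with (6 * (- (2) * (Zsum (csigma q) * G4 q) + (/ 6 * G4 q))
  - 6 * (- (2) * (Zsum (csigma q) * G4 q) + (/ 6 * G4 q + - / 6 * G6 q))) by field.
rewrite <- H. field.
Qed.

(** * Even families and polynomial weights *)

Lemma Zsum_even (f : Z -> C) : geoZ f -> (forall j, f (- j)%Z = f j) ->
  Zsum f = f 0%Z + 2 * CSeries (fun n => f (Z.of_nat (S n))) /\
  geo (fun n => f (Z.of_nat (S n))).
Proof.
intros Hf Heven.
assert (Hg : geo (fun n => f (Z.of_nat (S n)))).
{ destruct Hf as [K [r [Hr H]]]. exists (K * r)%R, r. split; [exact Hr|]. intros n.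
  specialize (H (Z.of_nat (S n))).
  replace (Z.abs_nat (Z.of_nat (S n))) with (S n) in H by lia.
  simpl in *. lra. }
split; [|exact Hg].
unfold Zsum. rewrite CSeries_S by now apply geoZ_zterm. rewrite <- CSeries_scal by exact Hg.
f_equal. apply CSeries_ext. intros n. unfold zterm. rewrite Heven. ring.
Qed.

Lemma geo_mult_linear_pow (c a : nat -> C) (M : R) (k : nat) :
  (forall n, (Cmod (c n) <= M * (INR n + 1))%R) ->
  geo a -> geo (fun n => c n ^ k * a n).
Proof.
intros Hc Ha. induction k as [|k [K [r [Hr H]]]].
- apply (geo_ext a _ Ha). intros n. simpl. ring.
- destruct (geo_rate_absorb r Hr) as [M' [rho [Hrho HM']]].
  assert (HK := geo_K_ge0 _ _ _ H).
  exists (M * K * M')%R, rho. split; [exact Hrho|]. intros n.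
  specialize (Hc n). specialize (H n). specialize (HM' n).
  assert (0 <= INR n)%R by apply pos_INR.
  pose proof (Cmod_ge_0 (c n)). pose proof (Cmod_ge_0 (c n ^ k * a n)).
  assert (HM : (0 <= M)%R) by nra.
  rewrite Cpow_S, <- Cmult_assoc, Cmod_mult.
  eapply Rle_trans; [apply Rmult_le_compat; eassumption|].
  replace (M * (INR n + 1) * (K * r ^ n))%R
    with (M * K * ((INR n + 1) * r ^ n))%R by ring.
  rewrite (Rmult_assoc (M * K)). apply Rmult_le_compat_l; [nra|exact HM'].
Qed.

Lemma geo_INR_S_pow (a : nat -> C) (k : nat) : geo a ->
  geo (fun n => RtoC (INR (S n)) ^ k * a n).
Proof.
apply (geo_mult_linear_pow _ a 1). intros n.
rewrite Cmod_R, Rabs_pos_eq, S_INR by apply pos_INR. lra.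
Qed.

Lemma geo_INR_pow (a : nat -> C) (k : nat) : geo a ->
  geo (fun n => RtoC (INR n) ^ k * a n).
Proof.
apply (geo_mult_linear_pow _ a 1). intros n.
rewrite Cmod_R, Rabs_pos_eq by apply pos_INR. lra.
Qed.

Lemma geo_sign (a : nat -> C) : geo a -> geo (fun n => (- (1)) ^ n * a n).
Proof.
apply (geo_mult_bounded _ a 1). intros n.
rewrite Cmod_pow, Cmod_m1, pow1. apply Rle_refl.
Qed.

(** * Power series of [n^k] *)

(** The exponent [k] carries the weights (n+1)^k created by an index shift; [powsum_S] trades them
    for powers of n one factor at a time, which replaces the binomial theorem. *)
Definition powsum (a k : nat) (x : C) : C :=
  CSeries (fun n => RtoC (INR n) ^ a * (RtoC (INR (S n)) ^ k * x ^ n)).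

Lemma geo_powsum (a k : nat) (x : C) : (Cmod x < 1)%R ->
  geo (fun n => RtoC (INR n) ^ a * (RtoC (INR (S n)) ^ k * x ^ n)).
Proof. intros Hx. now apply geo_INR_pow, geo_INR_S_pow, geo_pow. Qed.

Lemma powsum_S (a k : nat) (x : C) : (Cmod x < 1)%R ->
  powsum a (S k) x = powsum (S a) k x + powsum a k x.
Proof.
intros Hx. unfold powsum. rewrite <- CSeries_plus by now apply geo_powsum.
apply CSeries_ext. intros n. rewrite !Cpow_S, S_INR, RtoC_plus. ring.
Qed.

Lemma powsum_shift (k : nat) (x : C) : (Cmod x < 1)%R ->
  powsum k 0 x = RtoC 0 ^ k + x * powsum 0 k x.
Proof.
intros Hx. unfold powsum.
rewrite CSeries_S, <- CSeries_scal by now apply geo_powsum.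
f_equal; [simpl INR; simpl; ring|].
apply CSeries_ext. intros n. rewrite Cpow_S. simpl pow. ring.
Qed.

Lemma fixpoint_solve (x e t rhs : C) : 1 - x <> 0 ->
  e = rhs -> rhs - x * e = (1 - x) * t -> e = t.
Proof.
intros Hx He Ht. rewrite <- He in Ht.
replace e with ((e - x * e) / (1 - x)) by (field; exact Hx).
rewrite Ht. field. exact Hx.
Qed.

(** Once expanded, the shift equation reads E = R + x E, where R contains only sums of lower order;
    [fixpoint_solve] divides by 1 - x. *)
Ltac solve_powsum k x Hx Hx1 :=
  let H := fresh in
  pose proof (powsum_shift k x Hx) as H; rewrite ?powsum_S in H by exact Hx;
  apply (fixpoint_solve x _ _ _ Hx1 H).

(** The sum of n^k x^n is (x d/dx)^(k-1) b, and b = -a(-x), so the even derivatives of b are those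
    of a up to sign. The numerators in the proof are the Eulerian polynomials. *)
Lemma powsum_closed (x : C) : (Cmod x < 1)%R ->
  let b := x / (1 - x) ^ 2 in
  powsum 1 0 x = b /\ powsum 3 0 x = - D2 (- b) /\
  powsum 5 0 x = - D4 (- b) /\ powsum 7 0 x = - D6 (- b).
Proof.
intros Hx b. assert (Hx1 := one_minus_neq0 x Hx).
assert (H0 : powsum 0 0 x = / (1 - x)).
{ solve_powsum 0%nat x Hx Hx1. simpl Cpow. field. exact Hx1. }
assert (H1 : powsum 1 0 x = x / (1 - x) ^ 2).
{ solve_powsum 1%nat x Hx Hx1. rewrite H0. field. exact Hx1. }
assert (H2 : powsum 2 0 x = x * (1 + x) / (1 - x) ^ 3).
{ solve_powsum 2%nat x Hx Hx1. rewrite H0, H1. field. exact Hx1. }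
assert (H3 : powsum 3 0 x = x * (1 + 4 * x + x ^ 2) / (1 - x) ^ 4).
{ solve_powsum 3%nat x Hx Hx1. rewrite H0, H1, H2. field. exact Hx1. }
assert (H4 : powsum 4 0 x = x * (1 + 11 * x + 11 * x ^ 2 + x ^ 3) / (1 - x) ^ 5).
{ solve_powsum 4%nat x Hx Hx1. rewrite H0, H1, H2, H3. field. exact Hx1. }
assert (H5 : powsum 5 0 x =
  x * (1 + 26 * x + 66 * x ^ 2 + 26 * x ^ 3 + x ^ 4) / (1 - x) ^ 6).
{ solve_powsum 5%nat x Hx Hx1. rewrite H0, H1, H2, H3, H4. field. exact Hx1. }
assert (H6 : powsum 6 0 x =
  x * (1 + 57 * x + 302 * x ^ 2 + 302 * x ^ 3 + 57 * x ^ 4 + x ^ 5) / (1 - x) ^ 7).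
{ solve_powsum 6%nat x Hx Hx1. rewrite H0, H1, H2, H3, H4, H5. field. exact Hx1. }
assert (H7 : powsum 7 0 x =
  x * (1 + 120 * x + 1191 * x ^ 2 + 2416 * x ^ 3 + 1191 * x ^ 4 + 120 * x ^ 5 + x ^ 6)
  / (1 - x) ^ 8).
{ solve_powsum 7%nat x Hx Hx1. rewrite H0, H1, H2, H3, H4, H5, H6. field. exact Hx1. }
rewrite H1, H3, H5, H7. unfold b, D2, D4, D6.
repeat split; field; exact Hx1.
Qed.

(** * Lambert series *)

Lemma lambert_swap (q : C) (f g : nat -> C) : (Cmod q < 1)%R ->
  geo (fun n => f n * q ^ n) -> geo (fun m => g m * q ^ m) ->
  CSeries (fun n => CSeries (fun m => f n * g m * q ^ (S n * S m))) =
  CSeries (fun m => CSeries (fun n => f n * g m * q ^ (S n * S m))).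
Proof.
intros Hq Hf Hg. apply CSeries_fubini. apply (geo2_intro _ _ _ Hf Hg).
intros n m. rewrite !Cmod_mult, !Cmod_pow.
assert (H : (Cmod q ^ (S n * S m) <= Cmod q ^ n * Cmod q ^ m)%R).
{ rewrite <- pow_add. pose proof (Cmod_ge_0 q). apply pow_le_exponent; [lra|nia]. }
replace (Cmod (f n) * Cmod q ^ n * (Cmod (g m) * Cmod q ^ m))%R
  with (Cmod (f n) * Cmod (g m) * (Cmod q ^ n * Cmod q ^ m))%R by ring.
apply Rmult_le_compat_l; [apply Rmult_le_pos; apply Cmod_ge_0|exact H].
Qed.

Lemma CSeries_geom (x : C) : (Cmod x < 1)%R -> CSeries (fun n => x ^ n) = / (1 - x).
Proof.
intros Hx. assert (Hx1 := one_minus_neq0 x Hx).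
assert (H := CSeries_S _ (geo_pow x Hx)). cbv beta in H.
rewrite (CSeries_ext (fun n => x ^ S n) (fun n => x * x ^ n) (Cpow_S x)) in H.
rewrite (CSeries_scal x (fun n => x ^ n) (geo_pow x Hx)) in H.
apply (fixpoint_solve x _ _ _ Hx1 H). simpl Cpow at 1. field. exact Hx1.
Qed.

(** The index [n] stands for the Lambert index n + 1, whence the sign. *)
Definition lambert (k : nat) (q : C) : C :=
  CSeries (fun n => (- (1)) ^ n * RtoC (INR (S n)) ^ k * (q ^ S n / (1 - q ^ S n))).

Lemma powsum_sign (k : nat) (w : C) : (Cmod w < 1)%R ->
  CSeries (fun n => (- (1)) ^ n * RtoC (INR (S n)) ^ S k * w ^ S n) = - powsum (S k) 0 (- w).
Proof.
intros Hw. assert (Hw' : (Cmod (- w) < 1)%R) by now rewrite Cmod_opp.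
unfold powsum. rewrite (CSeries_S _ (geo_powsum (S k) 0 (- w) Hw')).
rewrite (CSeries_ext (fun n => (- (1)) ^ n * _ * _) (fun n => (- (1)) *
  (RtoC (INR (S n)) ^ S k * (RtoC (INR (S (S n))) ^ 0 * (- w) ^ S n)))).
- rewrite CSeries_scal by exact (geo_S _ (geo_powsum (S k) 0 (- w) Hw')).
  rewrite Cpow_S. simpl INR. ring.
- intros n. replace (- w) with (- (1) * w) by ring. rewrite Cpow_mult_l, !Cpow_S. ring.
Qed.

(** Each q^n/(1-q^n) is expanded as a geometric series in the powers q^(nm), and the sum over n is
    taken first. *)
Lemma lambert_as_powsum (k : nat) (q : C) : (Cmod q < 1)%R ->
  lambert (S k) q = CSeries (fun m => - powsum (S k) 0 (- q ^ S m)).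
Proof.
intros Hq.
transitivity (CSeries (fun n => CSeries (fun m =>
  (- (1)) ^ n * RtoC (INR (S n)) ^ S k * 1 * q ^ (S n * S m)))).
- apply CSeries_ext. intros n. assert (Hn := Cmod_pow_lt1 q n Hq).
  rewrite (CSeries_ext _ (fun m =>
    (- (1)) ^ n * RtoC (INR (S n)) ^ S k * q ^ S n * (q ^ S n) ^ m)).
  + rewrite CSeries_scal, CSeries_geom by (try apply geo_pow; exact Hn).
    unfold Cdiv. ring.
  + intros m. rewrite Cpow_mult_r, (Cpow_S (q ^ S n)). ring.
- rewrite (lambert_swap q (fun n => (- (1)) ^ n * RtoC (INR (S n)) ^ S k) (fun _ => 1) Hq).
  + apply CSeries_ext. intros m. rewrite <- powsum_sign by now apply Cmod_pow_lt1.
    apply CSeries_ext. intros n.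
    rewrite (Nat.mul_comm (S n)), Cpow_mult_r. ring.
  + apply (geo_ext _ _ (geo_sign _ (geo_INR_S_pow _ (S k) (geo_pow q Hq)))).
    intros n. ring.
  + apply (geo_ext _ _ (geo_pow q Hq)). intros n. ring.
Qed.

Lemma lambert_closed (q : C) : (Cmod q < 1)%R ->
  lambert 1 q = CSeries (fun m => av q (Z.of_nat (S m))) /\
  lambert 3 q = CSeries (fun m => D2 (av q (Z.of_nat (S m)))) /\
  lambert 5 q = CSeries (fun m => D4 (av q (Z.of_nat (S m)))) /\
  lambert 7 q = CSeries (fun m => D6 (av q (Z.of_nat (S m)))).
Proof.
intros Hq. rewrite !lambert_as_powsum by exact Hq.
assert (Hx : forall m, (Cmod (- q ^ S m) < 1)%R)
  by (intros m; rewrite Cmod_opp; now apply Cmod_pow_lt1).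
assert (Hb : forall m, - (- q ^ S m / (1 - - q ^ S m) ^ 2) = av q (Z.of_nat (S m))).
{ intros m. unfold av. rewrite qz_of_nat. assert (H := one_minus_neq0 _ (Hx m)).
  replace (1 + q ^ S m) with (1 - - q ^ S m) by ring. field. exact H. }
repeat split; apply CSeries_ext; intros m; rewrite <- Hb;
  destruct (powsum_closed _ (Hx m)) as [H1 [H3 [H5 H7]]];
  rewrite ?H1, ?H3, ?H5, ?H7; ring.
Qed.

Lemma D_even_at_quarter : D2 (/ 4) = - / 8 /\ D4 (/ 4) = / 4 /\ D6 (/ 4) = - (17) / 16.
Proof. unfold D2, D4, D6. repeat split; field. Qed.

(** The constants are a, D^2 a, D^4 a, D^6 a at w = 1, the term j = 0; the terms j and -j agree, and
    together they give twice the Lambert series. *)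
Lemma G_lambert (q : C) : q <> 0 -> (Cmod q < 1)%R ->
  G0 q = / 4 + 2 * lambert 1 q /\ G2 q = - / 8 + 2 * lambert 3 q /\
  G4 q = / 4 + 2 * lambert 5 q /\ G6 q = - (17) / 16 + 2 * lambert 7 q.
Proof.
intros Hq0 Hq. destruct (lambert_closed q Hq) as [-> [-> [-> ->]]].
destruct D_even_at_quarter as [E2 [E4 E6]].
assert (Ha := geoZ_av q Hq0 Hq). assert (Hev := fun j => av_even q j Hq0 Hq).
assert (E : av q 0 = / 4) by (unfold av; simpl; field).
unfold G0, G2, G4, G6.
rewrite (proj1 (Zsum_even _ Ha Hev)).
rewrite (proj1 (Zsum_even _ (geoZ_D2 _ Ha) (fun j => f_equal D2 (Hev j)))).
rewrite (proj1 (Zsum_even _ (geoZ_D4 _ Ha) (fun j => f_equal D4 (Hev j)))).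
rewrite (proj1 (Zsum_even _ (geoZ_D6 _ Ha) (fun j => f_equal D6 (Hev j)))).
rewrite E, E2, E4, E6. repeat split.
Qed.

Lemma sum_n_odd_part (a : nat -> C) (N : nat) :
  sum_n (fun n => (1 - (- (1)) ^ n) * a n) (2 * N + 1) =
  sum_n (fun n => 2 * a (2 * n + 1)%nat) N.
Proof.
assert (Hs : forall n, (- (1)) ^ (2 * n) = RtoC 1).
{ intros n. rewrite Cpow_mult_r. replace ((- (1)) ^ 2) with (RtoC 1) by ring. apply Cpow_1_l. }
induction N as [|N IH].
- change (2 * 0 + 1)%nat with 1%nat. rewrite sum_Sn, !sum_O. simpl. change plus with Cplus.
  C_ring.
- replace (2 * S N + 1)%nat with (S (S (2 * N + 1))) by lia.
  rewrite !sum_Sn, IH. change plus with Cplus.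
  replace (S (S (2 * N + 1))) with (S (2 * S N)) by lia.
  replace (S (2 * N + 1)) with (2 * S N)%nat by lia.
  rewrite Nat.add_1_r, Cpow_S, Hs. C_ring.
Qed.

(** The weight 1 - (-1)^n is 0 or 2. For sums indexed from d = 1 by n = d - 1, odd n means even
    d. *)
Lemma CSeries_odd_part (a : nat -> C) : geo a ->
  CSeries (fun n => (1 - (- (1)) ^ n) * a n) = CSeries (fun n => 2 * a (2 * n + 1)%nat).
Proof.
intros Ha. symmetry. apply CSeries_unique.
assert (Hg : geo (fun n => (1 - (- (1)) ^ n) * a n)).
{ apply (geo_mult_bounded _ a 2); [|exact Ha]. intros n.
  eapply Rle_trans; [apply Cmod_triangle|].
  rewrite Cmod_opp, Cmod_pow, Cmod_m1, pow1, Cmod_1. lra. }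
apply is_series_C_spec. intros eps Heps.
destruct (proj1 (is_series_C_spec _ _) (geo_is_series _ Hg) eps Heps) as [N HN].
exists N. intros n Hn. rewrite <- sum_n_odd_part. apply HN. lia.
Qed.

(** After expanding q^n/(1+q^n) in powers of -q^n, the inner sum over n is the sum of n x^n at x =
    q^(m+1), which is x/(1-x)^2. *)
Lemma lambert_e (q : C) : (Cmod q < 1)%R ->
  CSeries (fun n => RtoC (INR (S n)) * (q ^ S n / (1 + q ^ S n))) =
  CSeries (fun m => (- (1)) ^ m * csigma q (Z.of_nat (S m))).
Proof.
intros Hq.
transitivity (CSeries (fun n => CSeries (fun m =>
  RtoC (INR (S n)) * (- (1)) ^ m * q ^ (S n * S m)))).
- apply CSeries_ext. intros n. assert (Hn := Cmod_pow_lt1 q n Hq).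
  assert (Hn' : (Cmod (- q ^ S n) < 1)%R) by now rewrite Cmod_opp.
  rewrite (CSeries_ext _ (fun m => RtoC (INR (S n)) * q ^ S n * (- q ^ S n) ^ m)).
  + rewrite CSeries_scal, CSeries_geom by (try apply geo_pow; exact Hn').
    unfold Cdiv. replace (1 - - q ^ S n) with (1 + q ^ S n) by ring. ring.
  + intros m. replace (- q ^ S n) with (- (1) * q ^ S n) by ring.
    rewrite Cpow_mult_l, Cpow_mult_r, (Cpow_S (q ^ S n)). ring.
- rewrite (lambert_swap q (fun n => RtoC (INR (S n))) (fun m => (- (1)) ^ m) Hq).
  + apply CSeries_ext. intros m. assert (Hm := Cmod_pow_lt1 q m Hq).
    unfold csigma. replace (Z.eqb _ 0) with false by (symmetry; apply Z.eqb_neq; lia).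
    rewrite qz_of_nat.
    destruct (powsum_closed _ Hm) as [H1 _]. rewrite <- H1.
    unfold powsum. rewrite (CSeries_S _ (geo_powsum 1 0 (q ^ S m) Hm)).
    assert (Hg := geo_S _ (geo_powsum 1 0 (q ^ S m) Hm)). cbv beta in *.
    simpl INR at 2.
    replace (RtoC 0 ^ 1 * (RtoC (INR 1) ^ 0 * (q ^ S m) ^ 0)) with (RtoC 0) by ring.
    rewrite Cplus_0_l, <- CSeries_scal by exact Hg.
    apply CSeries_ext. intros n. rewrite (Nat.mul_comm (S n)), Cpow_mult_r. ring.
  + apply (geo_ext _ _ (geo_INR_S_pow _ 1 (geo_pow q Hq))). intros n. ring.
  + now apply geo_sign, geo_pow.
Qed.

(** From (1+w)^2 - (1-w)^2 = 4w one gets w/(1-w)^2 - w/(1+w)^2 = 4w^2/(1-w^2)^2, here with w =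
    q^(m+1). *)
Lemma av_sigma (q : C) (m : nat) : q <> 0 -> (Cmod q < 1)%R ->
  av q (Z.of_nat (S m)) =
  csigma q (Z.of_nat (S m)) - 4 * csigma q (Z.of_nat (S (2 * m + 1))).
Proof.
intros Hq0 Hq. unfold csigma.
replace (Z.eqb (Z.of_nat (S m)) 0) with false by (symmetry; apply Z.eqb_neq; lia).
replace (Z.eqb (Z.of_nat (S (2 * m + 1))) 0) with false by (symmetry; apply Z.eqb_neq; lia).
unfold av. rewrite !qz_of_nat. replace (S (2 * m + 1)) with (S m * 2)%nat by lia.
rewrite Cpow_mult_r. set (w := q ^ S m).
assert (Hw : (Cmod w < 1)%R) by now apply Cmod_pow_lt1.
assert (H1 := one_minus_neq0 w Hw). assert (H2 := one_plus_neq0 w Hw).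
assert (H3 : 1 - w ^ 2 <> 0).
{ apply one_minus_neq0. unfold w. rewrite <- Cpow_mult_r.
  replace (S m * 2)%nat with (S (2 * m + 1)) by lia. now apply Cmod_pow_lt1. }
field. repeat split; assumption.
Qed.

Definition eser (q : C) : C :=
  1 + 24 * CSeries (fun n => RtoC (INR (S n)) * (q ^ S n / (1 + q ^ S n))).

(** By [av_sigma] the sum of a(q^d) over d > 0 is the full sum of [csigma] minus four times its part
    with even d, and twice that part is the full sum minus the alternating one. The full sums cancel
    against 12 s; the alternating sum remains and is evaluated by [lambert_e]. *)
Lemma G0_sigma_eser (q : C) : q <> 0 -> (Cmod q < 1)%R ->
  1 - 12 * Zsum (csigma q) - 12 * G0 q = - (2) * eser q.
Proof.
intros Hq0 Hq. destruct (G_lambert q Hq0 Hq) as [-> _].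
destruct (lambert_closed q Hq) as [-> _].
destruct (Zsum_even (csigma q) (geoZ_sigma q Hq0 Hq) (fun j => sigma_even q j Hq0 Hq))
  as [-> Hs].
set (s := fun n => csigma q (Z.of_nat (S n))) in *.
assert (Hs2 : geo (fun n => 2 * s (2 * n + 1)%nat)).
{ apply geo_scal. destruct Hs as [K [r [Hr H]]]. exists K, r. split; [exact Hr|]. intros n.
  eapply Rle_trans; [apply H|]. apply Rmult_le_compat_l; [exact (geo_K_ge0 _ _ _ H)|].
  apply pow_le_exponent; [lra|lia]. }
assert (Hodd := CSeries_odd_part s Hs).
assert (Hsg := geo_sign s Hs).
rewrite (CSeries_ext _ (fun n => s n + - (1) * ((- (1)) ^ n * s n))) in Hodd by (intros; ring).
rewrite CSeries_plus, CSeries_scal in Hodd by (try apply geo_scal; assumption).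
rewrite (CSeries_ext (fun m => av q (Z.of_nat (S m)))
  (fun m => s m + - (2) * (2 * s (2 * m + 1)%nat)))
  by (intros m; rewrite av_sigma by assumption; unfold s; ring).
rewrite CSeries_plus, CSeries_scal by (first [assumption|apply geo_scal; assumption]).
rewrite <- Hodd. unfold eser. rewrite lambert_e by exact Hq. fold s.
change (CSeries (fun m => (- (1)) ^ m * csigma q (Z.of_nat (S m))))
  with (CSeries (fun m => (- (1)) ^ m * s m)).
unfold csigma at 1. simpl Z.eqb. cbv iota. field.
Qed.

(** * Theta moments *)

Definition tri (n : Z) : nat := Z.to_nat (n * (n + 1) / 2).

(** The coefficient of z^(n+1/2) in F. *)
Definition tz (q : C) (n : Z) : C := q ^ tri n.

Lemma tri_spec (n : Z) : (2 * Z.of_nat (tri n) = n * (n + 1))%Z.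
Proof.
unfold tri.
assert (He : (n * (n + 1) = 2 * (n * (n + 1) / 2))%Z).
{ apply Z_div_exact_full_2; [lia|].
  destruct (Z.Even_or_Odd n) as [[k ->]|[k ->]].
  - replace (2 * k * (2 * k + 1))%Z with (k * (2 * k + 1) * 2)%Z by ring. apply Z_mod_mult.
  - replace ((2 * k + 1) * (2 * k + 1 + 1))%Z with ((2 * k + 1) * (k + 1) * 2)%Z by ring.
    apply Z_mod_mult. }
rewrite Z2Nat.id; nia.
Qed.

Lemma tri_triangular (n : nat) : tri (Z.of_nat n) = triangular n.
Proof.
apply Nat2Z.inj. unfold triangular. rewrite Nat2Z.inj_div, Nat2Z.inj_mul, Nat2Z.inj_add.
change (Z.of_nat 1) with 1%Z. change (Z.of_nat 2) with 2%Z.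
now rewrite <- tri_spec, Z.mul_comm, Z.div_mul.
Qed.

Lemma tz_reflect (q : C) (n : Z) : tz q (- 1 - n) = tz q n.
Proof.
unfold tz. f_equal. pose proof (tri_spec n). pose proof (tri_spec (- 1 - n)). nia.
Qed.

Lemma tz_step (q : C) (n m : Z) : q <> 0 -> m = Z.pred n -> tz q n = qz q n * tz q m.
Proof.
intros Hq0 ->. unfold tz. rewrite <- !qz_of_nat, <- qz_add by exact Hq0. f_equal.
pose proof (tri_spec n). pose proof (tri_spec (Z.pred n)). nia.
Qed.

Lemma geoZ_tz (q : C) : q <> 0 -> (Cmod q < 1)%R -> geoZ (tz q).
Proof.
intros Hq0 Hq. assert (H0 : (0 < Cmod q)%R) by now apply Cmod_gt_0.
(* The constant 1/|q| pays for |n| <= [tri n] + 1, which is sharp at n = -1 and n = -2. *)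
exists (/ Cmod q)%R, (Cmod q). split; [lra|]. intros n. unfold tz. rewrite Cmod_pow.
apply Rmult_le_reg_l with (Cmod q); [exact H0|].
rewrite <- Rmult_assoc, Rinv_r, Rmult_1_l by lra.
change (Cmod q * Cmod q ^ tri n)%R with (Cmod q ^ S (tri n))%R.
apply pow_le_exponent; [lra|]. pose proof (tri_spec n). nia.
Qed.

(** * The logarithmic derivative of F, coefficient by coefficient *)

Lemma geoZ_nat (f : Z -> C) : geoZ f -> geo (fun n => f (Z.of_nat n)).
Proof.
intros [K [r [Hr H]]]. exists K, r. split; [exact Hr|]. intros n.
specialize (H (Z.of_nat n)). now rewrite Zabs2Nat.id in H.
Qed.

(** The coefficient of z^(n+1/2) in F(z)/(1+z), with 1/(1+z) expanded in powers of 1/z.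
    [alt_tail_reflect] says that the expansion in powers of z gives the same coefficient, that is, F
    vanishes at z = -1. *)
Definition alt_tail (q : C) (n : Z) : C :=
  CSeries (fun m => (- (1)) ^ m * tz q (Z.of_nat m + (n + 1))).

Lemma geo_alt_tail (q : C) (n : Z) : q <> 0 -> (Cmod q < 1)%R ->
  geo (fun m => (- (1)) ^ m * tz q (Z.of_nat m + n)).
Proof.
intros Hq0 Hq. apply geo_sign, (geoZ_nat (fun m => tz q (m + n))), geoZ_shift.
now apply geoZ_tz.
Qed.

Lemma alt_tail_step (q : C) (n : Z) : q <> 0 -> (Cmod q < 1)%R ->
  alt_tail q (Z.pred n) = tz q n - alt_tail q n.
Proof.
intros Hq0 Hq. unfold alt_tail. rewrite CSeries_S by now apply geo_alt_tail.
rewrite (CSeries_ext (fun m => (- (1)) ^ S m * _)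
  (fun m => - (1) * ((- (1)) ^ m * tz q (Z.of_nat m + (n + 1))))).
- rewrite CSeries_scal by now apply geo_alt_tail.
  replace (Z.of_nat 0 + (Z.pred n + 1))%Z with n by lia. simpl. ring.
- intros m. rewrite Cpow_S.
  replace (Z.of_nat (S m) + (Z.pred n + 1))%Z with (Z.of_nat m + (n + 1))%Z by lia. ring.
Qed.

(* The defect changes sign under [n -> n - 1] and is invariant under [n -> -1 - n]. *)
Lemma alt_tail_reflect (q : C) (n : Z) : q <> 0 -> (Cmod q < 1)%R ->
  alt_tail q n + alt_tail q (- 1 - n) = tz q n.
Proof.
intros Hq0 Hq. set (kap := fun n => tz q n - alt_tail q n - alt_tail q (- 1 - n)).
assert (Hstep : forall n, kap (Z.pred n) = - kap n).
{ intros k. unfold kap. rewrite alt_tail_step by assumption.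
  replace (- 1 - k)%Z with (Z.pred (- 1 - Z.pred k))%Z by lia.
  rewrite (alt_tail_step q (- 1 - Z.pred k)), tz_reflect by assumption. ring. }
assert (H0 : kap 0%Z = 0).
{ assert (H : kap 0%Z = - kap 0%Z).
  { rewrite <- Hstep. unfold kap. rewrite <- (tz_reflect q 0).
    change (Z.pred 0) with (- 1)%Z. change (- 1 - 0)%Z with (- 1)%Z.
    change (- 1 - - 1)%Z with 0%Z. ring. }
  replace (kap 0%Z) with ((kap 0%Z - - kap 0%Z) / 2) by field. rewrite <- H. field. }
assert (Hk : forall n, kap n = 0).
{ apply Z.peano_ind.
  - exact H0.
  - intros k IH. replace k with (Z.pred (Z.succ k)) in IH by lia. rewrite Hstep in IH.
    replace (kap (Z.succ k)) with (- - kap (Z.succ k)) by ring. rewrite IH. ring.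
  - intros k IH. rewrite Hstep, IH. ring. }
specialize (Hk n). unfold kap in Hk.
replace (tz q n) with (tz q n - alt_tail q n - alt_tail q (- 1 - n)
  + (alt_tail q n + alt_tail q (- 1 - n))) by ring.
rewrite Hk. ring.
Qed.

Definition lam (q : C) (k : nat) : C := (- (1)) ^ (k - 1) * (q ^ k / (1 - q ^ k)).

Definition chi (q : C) (m : Z) : C :=
  match m with
  | Z0 => 0
  | Zpos p => lam q (Pos.to_nat p)
  | Zneg p => - lam q (Pos.to_nat p)
  end.

Lemma chi_odd (q : C) (m : Z) : chi q (- m) = - chi q m.
Proof. destruct m; simpl; ring. Qed.

Lemma chi_nat (q : C) (n : nat) :
  chi q (Z.of_nat (S n)) = (- (1)) ^ n * (q ^ S n / (1 - q ^ S n)).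
Proof.
simpl Z.of_nat. unfold chi, lam. now rewrite SuccNat2Pos.id_succ, Nat.sub_1_r.
Qed.

Lemma geoZ_chi (q : C) : q <> 0 -> (Cmod q < 1)%R -> geoZ (chi q).
Proof.
intros Hq0 Hq. apply (geoZ_rational q _ (/ (1 - Cmod q)) Hq0 Hq).
- intros j. now rewrite chi_odd, Cmod_opp.
- intros [|n].
  + simpl. rewrite Cmod_0. apply Rmult_le_pos; [|apply Cmod_ge_0].
    left. apply Rinv_0_lt_compat. lra.
  + rewrite chi_nat, Cmod_mult, Cmod_pow, Cmod_m1, pow1, Rmult_1_l.
    destruct (qz_nat_bounds q n Hq) as [_ [_ H]].
    rewrite Rmult_comm. apply Cmod_div_bound; [lra|apply Rle_refl|exact H].
Qed.

(* [chi] collects the Lambert coefficients of the part of [D (log F)] with [j <> 0], so [Psi] is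
   that part times [F], and [Phi] the remaining [j = 0] term times [F]. *)
Definition Psi (q : C) (n : Z) : C := Zsum (fun m => chi q m * tz q (n - m)).

Lemma geo2Z_Psi (q : C) : q <> 0 -> (Cmod q < 1)%R ->
  geo2Z (fun n m => chi q m * tz q (n - m)).
Proof.
intros Hq0 Hq. pose proof (geo2Z_prod _ _ (geoZ_tz q Hq0 Hq) (geoZ_chi q Hq0 Hq)) as H.
apply (geo2Z_ext _ _ (geo2Z_skew _ H)). intros n m. ring.
Qed.

Lemma geoZ_Psi (q : C) : q <> 0 -> (Cmod q < 1)%R -> geoZ (Psi q).
Proof. intros Hq0 Hq. exact (geo2Z_sum _ (geo2Z_Psi q Hq0 Hq)). Qed.

Lemma Psi_reflect (q : C) (n : Z) : q <> 0 -> (Cmod q < 1)%R -> Psi q (- 1 - n) = - Psi q n.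
Proof.
intros Hq0 Hq. unfold Psi. rewrite <- Zsum_opp_index.
replace (- Zsum (fun m => chi q m * tz q (n - m)))
  with (- (1) * Zsum (fun m => chi q m * tz q (n - m))) by ring.
rewrite <- Zsum_scal by exact (geo2Z_row _ n (geo2Z_Psi q Hq0 Hq)).
apply Zsum_ext. intros m. rewrite chi_odd.
replace (- 1 - n - - m)%Z with (- 1 - (n - m))%Z by lia. rewrite tz_reflect. ring.
Qed.

(** This holds term by term. As [tz] at n - m is q^(n-m) times [tz] at n - 1 - m, the difference of
    the two sums carries the factor q^(-m) - 1, which cancels the denominator of [chi] and leaves
    alternating signs: m > 0 yields the tail at -n, m < 0 the tail at n. *)
Lemma Psi_step (q : C) (n : Z) : q <> 0 -> (Cmod q < 1)%R ->
  Psi q n = qz q n * Psi q (Z.pred n) + (qz q n * alt_tail q (- n) + alt_tail q n).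
Proof.
intros Hq0 Hq.
assert (Hg := fun n => geoZ_zterm _ (geo2Z_row _ n (geo2Z_Psi q Hq0 Hq))). cbv beta in Hg.
assert (Hr := fun n => geo_alt_tail q (n + 1) Hq0 Hq).
unfold Psi, Zsum, alt_tail.
rewrite <- !CSeries_scal by auto.
rewrite <- CSeries_plus by (try apply geo_scal; auto).
assert (Ht : forall n, geo (fun k => zterm (fun m => chi q m * tz q (n - m)) (S k)))
  by (intros k; exact (geo_S _ (Hg k))).
rewrite (CSeries_S _ (Hg n)), (CSeries_S _ (geo_scal _ _ (Hg (Z.pred n)))).
cbv beta. replace (zterm (fun m => chi q m * tz q (n - m)) 0) with (RtoC 0)
  by (simpl; ring).
replace (zterm (fun m => chi q m * tz q (Z.pred n - m)) 0) with (RtoC 0) by (simpl; ring).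
rewrite Cmult_0_r, !Cplus_0_l.
rewrite <- CSeries_plus
  by (first [apply geo_scal, Ht|apply geo_plus; [apply geo_scal|]; apply Hr]).
apply CSeries_ext. intros k. unfold zterm. rewrite !chi_odd, !chi_nat.
set (M := Z.of_nat (S k)).
rewrite (tz_step q (n - M) (Z.pred n - M)), (tz_step q (n - - M) (Z.pred n - - M))
  by (exact Hq0 || lia).
replace (Z.of_nat k + (- n + 1))%Z with (- 1 - (Z.pred n - M))%Z by lia.
rewrite tz_reflect.
replace (Z.of_nat k + (n + 1))%Z with (n - - M)%Z by lia.
rewrite (tz_step q (n - - M) (Z.pred n - - M)) by (exact Hq0 || lia).
rewrite !qz_diff, qz_opp by exact Hq0.
assert (HM : qz q M = q ^ S k) by apply qz_of_nat. rewrite HM.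
assert (H1 := Cpow_nz q (S k) Hq0). assert (H2 := one_minus_neq0 _ (Cmod_pow_lt1 q k Hq)).
generalize dependent (q ^ S k). intros Q HQ H1 H2.
generalize ((- (1)) ^ k). intros c. field. split; assumption.
Qed.

Lemma Psi_closed (q : C) (n : Z) : q <> 0 -> (Cmod q < 1)%R ->
  Psi q n = RtoC (IZR n) * tz q n + alt_tail q n.
Proof.
intros Hq0 Hq.
(* At n = 0 the step relates Psi(0) to Psi(-1) = - Psi(0), and so determines it. *)
assert (H0 : Psi q 0 = alt_tail q 0).
{ assert (H := Psi_step q 0 Hq0 Hq). rewrite <- (Z.sub_0_r (Z.pred 0)) in H.
  change (Z.pred 0) with (- 1)%Z in H. rewrite Psi_reflect in H by assumption.
  simpl qz in H. change (- 0)%Z with 0%Z in H.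
  replace (Psi q 0) with ((Psi q 0 - 1 * - Psi q 0) / 2) by field.
  rewrite H at 1. field. }
assert (Hpos : forall k : nat, Psi q (Z.of_nat k) =
  RtoC (IZR (Z.of_nat k)) * tz q (Z.of_nat k) + alt_tail q (Z.of_nat k)).
{ induction k as [|k IH].
  - simpl Z.of_nat. rewrite H0. ring.
  - rewrite Psi_step by assumption.
    replace (Z.pred (Z.of_nat (S k))) with (Z.of_nat k) by lia. rewrite IH.
    rewrite (tz_step q (Z.of_nat (S k)) (Z.of_nat k)) by (exact Hq0 || lia).
    replace (Z.of_nat (S k)) with (Z.of_nat k + 1)%Z at 5 by lia. rewrite plus_IZR, RtoC_plus.
    (* The tails at k and at -(k+1) add up to one more [tz q k], which raises the coefficient from k
       to k + 1. *)
    pose proof (alt_tail_reflect q (Z.of_nat k) Hq0 Hq) as Hr.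
    replace (- 1 - Z.of_nat k)%Z with (- Z.of_nat (S k))%Z in Hr by lia.
    rewrite <- Hr. ring. }
destruct (Z_le_gt_dec 0 n) as [Hn|Hn].
- rewrite <- (Z2Nat.id n Hn). apply Hpos.
- set (k := Z.to_nat (- 1 - n)).
  assert (En : n = (- 1 - Z.of_nat k)%Z) by (unfold k; lia).
  rewrite En, Psi_reflect, Hpos, tz_reflect, minus_IZR, RtoC_minus by assumption.
  rewrite <- (alt_tail_reflect q (Z.of_nat k) Hq0 Hq).
  change (IZR (- 1)) with (- (1))%R. rewrite RtoC_opp. ring.
Qed.

Definition Phi (q : C) (n : Z) : C := (RtoC (IZR n) + / 2) * tz q n - Psi q n.

(** The coefficients of (1+z) Phi(z) = (z-1)/2 F(z), that is, of Phi = F (z-1)/(2(z+1)). *)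
Lemma Phi_step (q : C) (n : Z) : q <> 0 -> (Cmod q < 1)%R ->
  Phi q n + Phi q (Z.pred n) = / 2 * tz q (Z.pred n) - / 2 * tz q n.
Proof.
intros Hq0 Hq. unfold Phi. rewrite !Psi_closed, alt_tail_step by assumption. field.
Qed.

(** * Moments of families over the integers *)

Definition odd_int (n : Z) : C := RtoC (IZR (2 * n + 1)).

Lemma odd_int_linear (n : Z) (c : R) :
  (Cmod (odd_int n + c) <= (2 + Rabs c) * (INR (Z.abs_nat n) + 1))%R.
Proof.
unfold odd_int. rewrite <- RtoC_plus, Cmod_R, INR_IZR_INZ, Zabs2Nat.id_abs.
rewrite plus_IZR, mult_IZR, abs_IZR.
pose proof (Rabs_pos (IZR n)). pose proof (Rabs_pos c).
assert (H1 : (Rabs (2 * IZR n + 1 + c) <= 2 * Rabs (IZR n) + 1 + Rabs c)%R)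
  by (unfold Rabs; repeat destruct Rcase_abs; lra).
nra.
Qed.

(** [odd_int n] is twice the exponent n + 1/2, so for c = 0 these are the derivatives (2D)^(a+k) at
    z = 1 of the series with coefficients [f]. The spare exponent [a] lets [mom_S] expand powers of
    the shifted weight one factor at a time. *)
Definition mom (f : Z -> C) (a : nat) (c : R) (k : nat) : C :=
  Zsum (fun n => odd_int n ^ a * ((odd_int n + c) ^ k * f n)).

Lemma geoZ_mom (f : Z -> C) (a : nat) (c : R) (k : nat) : geoZ f ->
  geoZ (fun n => odd_int n ^ a * ((odd_int n + c) ^ k * f n)).
Proof.
intros Hf.
apply (geoZ_mult_linear_pow odd_int _ (2 + Rabs 0)).
- intros n. pose proof (odd_int_linear n 0) as H. now rewrite Cplus_0_r in H.
- apply (geoZ_mult_linear_pow (fun n => odd_int n + c) _ (2 + Rabs c)); [|exact Hf].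
  intros n. apply odd_int_linear.
Qed.

Definition mom0 (f : Z -> C) (k : nat) : C := Zsum (fun n => odd_int n ^ k * f n).

Lemma geoZ_mom0 (f : Z -> C) (k : nat) : geoZ f -> geoZ (fun n => odd_int n ^ k * f n).
Proof.
intros Hf. apply (geoZ_ext _ _ (geoZ_mom f k 0 0 Hf)). intros n. simpl. ring.
Qed.

Lemma mom_O (f : Z -> C) (a : nat) (c : R) : mom f a c 0 = mom0 f a.
Proof. apply Zsum_ext. intros n. simpl. ring. Qed.

Lemma mom_S (f : Z -> C) (a : nat) (c : R) (k : nat) : geoZ f ->
  mom f a c (S k) = mom f (S a) c k + c * mom f a c k.
Proof.
intros Hf. unfold mom.
rewrite <- Zsum_scal, <- Zsum_plus by (try apply geoZ_scal; now apply geoZ_mom).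
apply Zsum_ext. intros n. rewrite !Cpow_S. ring.
Qed.

Lemma Zsum_pred (f g : Z -> C) : geoZ f -> (forall n, f (Z.pred n) = g n) -> Zsum g = Zsum f.
Proof.
intros Hf H. rewrite <- (Zsum_shift f (- 1) Hf). apply Zsum_ext. intros n. rewrite <- H.
reflexivity.
Qed.

Lemma odd_int_pred (n : Z) : odd_int (Z.pred n) + 1%R = odd_int n + (- 1)%R.
Proof.
unfold odd_int. rewrite <- !RtoC_plus, <- !plus_IZR. do 2 f_equal. lia.
Qed.

Lemma geoZ_Phi (q : C) : q <> 0 -> (Cmod q < 1)%R -> geoZ (Phi q).
Proof.
intros Hq0 Hq.
apply (geoZ_ext _ _ (geoZ_plus _ _ (geoZ_scal (/ 2) _ (geoZ_mom0 _ 1 (geoZ_tz q Hq0 Hq)))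
  (geoZ_scal (- (1)) _ (geoZ_Psi q Hq0 Hq)))).
intros n. unfold Phi, odd_int. rewrite plus_IZR, mult_IZR, RtoC_plus, RtoC_mult. field.
Qed.

(* Weighting [Phi_step] by [(2 n)^k]: here [2 n] is [N - 1] at [n] and [N + 1] at [n - 1]. *)
Lemma mom_Phi (q : C) (k : nat) : q <> 0 -> (Cmod q < 1)%R ->
  mom (Phi q) 0 (- 1) k + mom (Phi q) 0 1 k =
  / 2 * mom (tz q) 0 1 k + - / 2 * mom (tz q) 0 (- 1) k.
Proof.
intros Hq0 Hq.
assert (Ht := geoZ_tz q Hq0 Hq). assert (HP := geoZ_Phi q Hq0 Hq).
assert (Hm := geoZ_mom (Phi q) 0 (- 1) k HP). assert (Hm' := geoZ_mom (tz q) 0 (- 1) k Ht).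
assert (Hshift : forall f, geoZ f ->
  geoZ (fun n => odd_int n ^ 0 * ((odd_int n + (- 1)%R) ^ k * f (Z.pred n))) /\
  mom f 0 1 k = Zsum (fun n => odd_int n ^ 0 * ((odd_int n + (- 1)%R) ^ k * f (Z.pred n)))).
{ intros f Hf. split.
  - apply (geoZ_ext _ _ (geoZ_shift _ (- 1) (geoZ_mom f 0 1 k Hf))). intros n.
    replace (n + -1)%Z with (Z.pred n) by lia. rewrite odd_int_pred. reflexivity.
  - symmetry. apply Zsum_pred; [now apply geoZ_mom|]. intros n.
    rewrite odd_int_pred. reflexivity. }
destruct (Hshift _ Ht) as [Ht1 ->]. destruct (Hshift _ HP) as [HP1 ->].
unfold mom.
rewrite <- !Zsum_scal, <- !Zsum_plus by (first [assumption|apply geoZ_scal; assumption]).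
apply Zsum_ext. intros n.
transitivity (odd_int n ^ 0 * ((odd_int n + (- 1)%R) ^ k * (Phi q n + Phi q (Z.pred n))));
  [ring|].
rewrite Phi_step by assumption. ring.
Qed.

Lemma Zsum_reflect (f : Z -> C) : geoZ f -> Zsum (fun n => f (- 1 - n)%Z) = Zsum f.
Proof.
intros Hf. rewrite <- (Zsum_opp_index f).
rewrite <- (Zsum_shift (fun n => f (- n)%Z) 1 (geoZ_opp_index f Hf)).
apply Zsum_ext. intros n. f_equal. lia.
Qed.

Lemma Zsum_fold (f : Z -> C) : geoZ f -> (forall n, f (- 1 - n)%Z = f n) ->
  Zsum f = 2 * CSeries (fun n => f (Z.of_nat n)).
Proof.
intros Hf Hrefl. assert (Hn := geoZ_nat f Hf). assert (HnS := geo_S _ Hn). cbv beta in HnS.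
unfold Zsum. rewrite CSeries_S by now apply geoZ_zterm.
rewrite (CSeries_ext _ (fun n => f (Z.of_nat (S n)) + f (Z.of_nat n))).
- rewrite CSeries_plus by assumption. rewrite (CSeries_S _ Hn). simpl zterm.
  change (Z.of_nat 0) with 0%Z. ring.
- intros n. unfold zterm. f_equal. rewrite <- Hrefl. f_equal. lia.
Qed.

Lemma odd_int_reflect (n : Z) : odd_int (- 1 - n) = - odd_int n.
Proof. unfold odd_int. rewrite <- RtoC_opp, <- opp_IZR. do 2 f_equal. lia. Qed.

Lemma Cpow_opp_even (x : C) (k : nat) : (- x) ^ (2 * k) = x ^ (2 * k).
Proof. rewrite !Cpow_mult_r. f_equal. ring. Qed.

Lemma mom0_odd (q : C) (k : nat) : q <> 0 -> (Cmod q < 1)%R -> mom0 (tz q) (2 * k + 1) = 0.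
Proof.
intros Hq0 Hq. assert (H := geoZ_mom0 _ (2 * k + 1) (geoZ_tz q Hq0 Hq)).
assert (E : mom0 (tz q) (2 * k + 1) = - (1) * mom0 (tz q) (2 * k + 1)).
{ unfold mom0. rewrite <- Zsum_scal by exact H. rewrite <- (Zsum_reflect _ H) at 1.
  apply Zsum_ext. intros n. rewrite odd_int_reflect, tz_reflect.
  rewrite !Cpow_add_r, Cpow_opp_even. ring. }
replace (mom0 (tz q) (2 * k + 1))
  with ((mom0 (tz q) (2 * k + 1) - - (1) * mom0 (tz q) (2 * k + 1)) / 2) by field.
rewrite <- E. field.
Qed.

Lemma mom0_even (q : C) (k : nat) : q <> 0 -> (Cmod q < 1)%R ->
  mom0 (tz q) (2 * k) =
  2 * CSeries (fun n => RtoC (INR (2 * n + 1)) ^ (2 * k) * q ^ triangular n).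
Proof.
intros Hq0 Hq. unfold mom0. rewrite Zsum_fold.
- f_equal. apply CSeries_ext. intros n. unfold tz, odd_int. rewrite tri_triangular.
  do 3 f_equal. rewrite INR_IZR_INZ. f_equal. lia.
- apply geoZ_mom0. now apply geoZ_tz.
- intros n. now rewrite odd_int_reflect, tz_reflect, Cpow_opp_even.
Qed.

(** The indices n and -1-n contribute equally, whence the 2; the leading 1 of [calT] is the term n =
    0. *)
Lemma mom0_calT (q : C) (k : nat) : q <> 0 -> (Cmod q < 1)%R ->
  mom0 (tz q) (2 * k) = 2 * calT k q.
Proof.
intros Hq0 Hq. rewrite mom0_even by assumption. f_equal.
rewrite CSeries_S.
- unfold calT, CSeries_from1. f_equal. simpl (2 * 0 + 1)%nat. simpl INR.
  rewrite Cpow_1_l. change (triangular 0) with 0%nat. simpl. ring.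
- apply (geo_ext _ _ (geoZ_nat _ (geoZ_mom0 _ (2 * k) (geoZ_tz q Hq0 Hq)))).
  intros n. unfold tz, odd_int. rewrite tri_triangular. do 3 f_equal.
  rewrite INR_IZR_INZ. f_equal. lia.
Qed.

Lemma mom0_psi (q : C) : q <> 0 -> (Cmod q < 1)%R -> mom0 (tz q) 0 = 2 * psi q.
Proof.
intros Hq0 Hq. change (mom0 (tz q) 0) with (mom0 (tz q) (2 * 0)).
rewrite mom0_even by assumption. f_equal. apply CSeries_ext. intros n. simpl. ring.
Qed.

(** * Moments of a convolution *)

Definition even_int (m : Z) : C := RtoC (IZR (2 * m)).

Lemma even_int_linear (m : Z) : (Cmod (even_int m) <= 2 * (INR (Z.abs_nat m) + 1))%R.
Proof.
unfold even_int. rewrite Cmod_R, INR_IZR_INZ, Zabs2Nat.id_abs, mult_IZR, abs_IZR, Rabs_mult.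
rewrite (Rabs_pos_eq 2) by lra. pose proof (Rabs_pos (IZR m)). lra.
Qed.

Lemma geoZ_even_pow (f : Z -> C) (b : nat) : geoZ f -> geoZ (fun m => even_int m ^ b * f m).
Proof. apply (geoZ_mult_linear_pow even_int f 2), even_int_linear. Qed.

(** In a convolution the weight splits as 2n + 1 = (2(n-m) + 1) + 2m. The exponents [a] and [b]
    collect the factors distributed so far, so that [bimom_S] is one application of the product
    rule. *)
Definition bimom (f g : Z -> C) (a b k : nat) : C :=
  Zsum2 (fun m j =>
    (odd_int j + even_int m) ^ k * ((odd_int j ^ a * f j) * (even_int m ^ b * g m))).

Lemma geo2Z_bimom (f g : Z -> C) (a b k : nat) : geoZ f -> geoZ g ->
  geo2Z (fun j m =>
    (odd_int j + even_int m) ^ k * ((odd_int j ^ a * f j) * (even_int m ^ b * g m))).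
Proof.
intros Hf Hg.
(* The inequality |x + y| <= (|x| + 1)(|y| + 1) separates the variables; these are the two resulting
   factors. *)
assert (Hf' : geoZ (fun j => RtoC (Cmod (odd_int j) + 1) ^ k * (odd_int j ^ a * f j))).
{ apply (geoZ_mult_linear_pow _ _ 3); [|now apply geoZ_mom0]. intros j.
  pose proof (odd_int_linear j 0) as H. rewrite Cplus_0_r, Rabs_R0, Rplus_0_r in H.
  pose proof (pos_INR (Z.abs_nat j)). pose proof (Cmod_ge_0 (odd_int j)).
  rewrite Cmod_R, Rabs_pos_eq by lra. lra. }
assert (Hg' : geoZ (fun m => RtoC (Cmod (even_int m) + 1) ^ k * (even_int m ^ b * g m))).
{ apply (geoZ_mult_linear_pow _ _ 3); [|now apply geoZ_even_pow]. intros m.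
  pose proof (even_int_linear m) as H.
  pose proof (pos_INR (Z.abs_nat m)). pose proof (Cmod_ge_0 (even_int m)).
  rewrite Cmod_R, Rabs_pos_eq by lra. lra. }
apply (geo2Z_intro _ _ _ Hf' Hg'). intros j m.
set (F := odd_int j ^ a * f j). set (G := even_int m ^ b * g m).
rewrite !Cmod_mult, !Cmod_pow, !Cmod_R.
pose proof (Cmod_ge_0 (odd_int j)). pose proof (Cmod_ge_0 (even_int m)).
rewrite !Rabs_pos_eq by lra.
assert (H1 : (Cmod (odd_int j + even_int m) ^ k <=
  (Cmod (odd_int j) + 1) ^ k * (Cmod (even_int m) + 1) ^ k)%R).
{ rewrite <- Rpow_mult_distr. apply pow_incr. split; [apply Cmod_ge_0|].
  eapply Rle_trans; [apply Cmod_triangle|]. nra. }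
pose proof (Cmod_ge_0 F). pose proof (Cmod_ge_0 G).
replace ((Cmod (odd_int j) + 1) ^ k * Cmod F * ((Cmod (even_int m) + 1) ^ k * Cmod G))%R
  with ((Cmod (odd_int j) + 1) ^ k * (Cmod (even_int m) + 1) ^ k * (Cmod F * Cmod G))%R by ring.
apply Rmult_le_compat_r; [nra|exact H1].
Qed.

Lemma bimom_S (f g : Z -> C) (a b k : nat) : geoZ f -> geoZ g ->
  bimom f g a b (S k) = bimom f g (S a) b k + bimom f g a (S b) k.
Proof.
intros Hf Hg. unfold bimom.
rewrite <- (Zsum2_plus _ _ (geo2Z_flip _ (geo2Z_bimom f g (S a) b k Hf Hg))
  (geo2Z_flip _ (geo2Z_bimom f g a (S b) k Hf Hg))).
apply Zsum2_ext. intros m j. rewrite !Cpow_S. ring.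
Qed.

Lemma bimom_O (f g : Z -> C) (a b : nat) : geoZ f -> geoZ g ->
  bimom f g a b 0 = mom0 f a * Zsum (fun m => even_int m ^ b * g m).
Proof.
intros Hf Hg. rewrite Cmult_comm. unfold mom0.
rewrite <- Zsum2_prod by (auto using geoZ_mom0, geoZ_even_pow).
apply Zsum2_ext. intros m j. simpl. ring.
Qed.

Lemma mom0_Psi (q : C) (k : nat) : q <> 0 -> (Cmod q < 1)%R ->
  mom0 (Psi q) k = bimom (tz q) (chi q) 0 0 k.
Proof.
intros Hq0 Hq.
assert (Ht := geoZ_tz q Hq0 Hq). assert (Hc := geoZ_chi q Hq0 Hq).
unfold bimom, Zsum2. rewrite <- (Zsum_skew _ (geo2Z_bimom (tz q) (chi q) 0 0 k Ht Hc)).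
apply Zsum_ext. intros n. unfold Psi.
rewrite <- Zsum_scal by exact (geo2Z_row _ n (geo2Z_Psi q Hq0 Hq)).
apply Zsum_ext. intros m.
replace (odd_int (n - m) + even_int m) with (odd_int n); [simpl; ring|].
unfold odd_int, even_int. rewrite <- RtoC_plus, <- plus_IZR. do 2 f_equal. lia.
Qed.

Lemma chi_moment_even (q : C) (k : nat) : q <> 0 -> (Cmod q < 1)%R ->
  Zsum (fun m => even_int m ^ (2 * k) * chi q m) = 0.
Proof.
intros Hq0 Hq. apply Zsum_odd; [now apply geoZ_even_pow, geoZ_chi|]. intros m.
rewrite chi_odd. replace (even_int (- m)) with (- even_int m).
- rewrite Cpow_opp_even. ring.
- unfold even_int. rewrite <- RtoC_opp, <- opp_IZR. do 2 f_equal. lia.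
Qed.

Lemma chi_moment_odd (q : C) (k : nat) : q <> 0 -> (Cmod q < 1)%R ->
  Zsum (fun m => even_int m ^ (2 * k + 1) * chi q m) =
  2 * (2 ^ (2 * k + 1) * lambert (2 * k + 1) q).
Proof.
intros Hq0 Hq.
assert (Hg := geoZ_even_pow _ (2 * k + 1) (geoZ_chi q Hq0 Hq)).
destruct (Zsum_even _ Hg) as [-> Hgn].
- intros m. rewrite chi_odd. replace (even_int (- m)) with (- even_int m).
  + rewrite !Cpow_add_r, Cpow_opp_even. ring.
  + unfold even_int. rewrite <- RtoC_opp, <- opp_IZR. do 2 f_equal. lia.
- assert (E : forall n, even_int (Z.of_nat (S n)) ^ (2 * k + 1) * chi q (Z.of_nat (S n)) =
    2 ^ (2 * k + 1) *
    ((- (1)) ^ n * RtoC (INR (S n)) ^ (2 * k + 1) * (q ^ S n / (1 - q ^ S n)))).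
  { intros n. rewrite chi_nat. unfold even_int.
    rewrite mult_IZR, RtoC_mult, Cpow_mult_l, <- INR_IZR_INZ. ring. }
  simpl chi at 1. rewrite Cmult_0_r, Cplus_0_l. f_equal.
  rewrite (CSeries_ext _ _ E). apply CSeries_scal.
  assert (H := geo_scal (/ 2 ^ (2 * k + 1)) _ Hgn).
  apply (geo_ext _ _ H). intros n. rewrite E, Cmult_assoc, Cinv_l, Cmult_1_l; [reflexivity|].
  apply Cpow_nz. intros E2. apply RtoC_inj in E2. lra.
Qed.

(** * The recursion for the theta moments *)

Lemma mom0_tz_step (q : C) (k : nat) : q <> 0 -> (Cmod q < 1)%R ->
  mom0 (tz q) (S k) = 2 * mom0 (Phi q) k + 2 * mom0 (Psi q) k.
Proof.
intros Hq0 Hq. unfold mom0.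
assert (HP := geoZ_mom0 _ k (geoZ_Phi q Hq0 Hq)).
assert (HQ := geoZ_mom0 _ k (geoZ_Psi q Hq0 Hq)).
rewrite <- !Zsum_scal, <- Zsum_plus by (first [assumption|apply geoZ_scal; assumption]).
apply Zsum_ext. intros n. unfold Phi. rewrite Cpow_S. unfold odd_int at 1.
rewrite plus_IZR, mult_IZR, RtoC_plus, RtoC_mult. field.
Qed.

Lemma chi_moments (q : C) : q <> 0 -> (Cmod q < 1)%R ->
  let X := fun b => Zsum (fun m => even_int m ^ b * chi q m) in
  (X 0%nat = 0 /\ X 2%nat = 0 /\ X 4%nat = 0 /\ X 6%nat = 0) /\
  X 1%nat = 4 * lambert 1 q /\ X 3%nat = 16 * lambert 3 q /\
  X 5%nat = 64 * lambert 5 q /\ X 7%nat = 256 * lambert 7 q.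
Proof.
intros Hq0 Hq X. split.
- repeat split; [exact (chi_moment_even q 0 Hq0 Hq)|exact (chi_moment_even q 1 Hq0 Hq)
    |exact (chi_moment_even q 2 Hq0 Hq)|exact (chi_moment_even q 3 Hq0 Hq)].
- unfold X. pose proof (chi_moment_odd q 0 Hq0 Hq) as H1.
  pose proof (chi_moment_odd q 1 Hq0 Hq) as H3.
  pose proof (chi_moment_odd q 2 Hq0 Hq) as H5. pose proof (chi_moment_odd q 3 Hq0 Hq) as H7.
  simpl Nat.add in *. repeat split.
  + etransitivity; [exact H1|]. ring.
  + etransitivity; [exact H3|]. ring.
  + etransitivity; [exact H5|]. ring.
  + etransitivity; [exact H7|]. ring.
Qed.

(** The Leibniz rule in odd order: unfolding the Pascal-type recursion produces the binomial
    coefficients. *)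
Lemma binomial_odd_expand (B : nat -> nat -> nat -> C) (F X : nat -> C) :
  (forall a b k, B a b (S k) = B (S a) b k + B a (S b) k) ->
  (forall a b, B a b O = F a * X b) ->
  B O O 1%nat = F 1%nat * X 0%nat + F 0%nat * X 1%nat /\
  B O O 3%nat = F 3%nat * X 0%nat + 3 * (F 2%nat * X 1%nat) + 3 * (F 1%nat * X 2%nat)
    + F 0%nat * X 3%nat /\
  B O O 5%nat = F 5%nat * X 0%nat + 5 * (F 4%nat * X 1%nat) + 10 * (F 3%nat * X 2%nat)
    + 10 * (F 2%nat * X 3%nat) + 5 * (F 1%nat * X 4%nat) + F 0%nat * X 5%nat /\
  B O O 7%nat = F 7%nat * X 0%nat + 7 * (F 6%nat * X 1%nat) + 21 * (F 5%nat * X 2%nat)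
    + 35 * (F 4%nat * X 3%nat) + 35 * (F 3%nat * X 4%nat) + 21 * (F 2%nat * X 5%nat)
    + 7 * (F 1%nat * X 6%nat) + F 0%nat * X 7%nat.
Proof.
intros HS HO. repeat split; rewrite !HS, !HO; ring.
Qed.

(** For odd k, (N-1)^k + (N+1)^k has only odd powers of N and (N+1)^k - (N-1)^k only even ones. The
    relation is therefore a triangular system for the odd moments [M] in terms of the even moments
    [F]. *)
Lemma euler_odd_expand (P T : nat -> R -> nat -> C) (M F : nat -> C) :
  (forall a c k, P a c (S k) = P (S a) c k + c * P a c k) -> (forall a c, P a c O = M a) ->
  (forall a c k, T a c (S k) = T (S a) c k + c * T a c k) -> (forall a c, T a c O = F a) ->
  (forall k, P O (- 1)%R k + P O 1%R k = / 2 * T O 1%R k + - / 2 * T O (- 1)%R k) ->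
  M 1%nat = F 0%nat / 2 /\
  M 3%nat = (3 * F 2%nat + F 0%nat) / 2 - 3 * M 1%nat /\
  M 5%nat = (5 * F 4%nat + 10 * F 2%nat + F 0%nat) / 2 - 10 * M 3%nat - 5 * M 1%nat /\
  M 7%nat = (7 * F 6%nat + 35 * F 4%nat + 21 * F 2%nat + F 0%nat) / 2
    - 21 * M 5%nat - 35 * M 3%nat - 7 * M 1%nat.
Proof.
intros PS PO TS TO H.
(* The top moment enters the relation with coefficient 2, once from each of the two shifts. *)
assert (HM : forall m V A B : C, A = B -> A - B = 2 * (m - V) -> m = V).
{ intros m V A B E E'. replace m with (2 * (m - V) / 2 + V) by field.
  rewrite <- E', E. field. }
repeat split.
- apply (HM _ _ _ _ (H 1%nat)). rewrite !PS, !PO, !TS, !TO. field.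
- apply (HM _ _ _ _ (H 3%nat)). rewrite !PS, !PO, !TS, !TO. field.
- apply (HM _ _ _ _ (H 5%nat)). rewrite !PS, !PO, !TS, !TO. field.
- apply (HM _ _ _ _ (H 7%nat)). rewrite !PS, !PO, !TS, !TO. field.
Qed.

(** The coefficients follow one rule: F(k+1) is the sum over odd b of binom(k,b) 2^(b+1) g_(b-1)
    F(k-b). This is D^k of D F = F . L with L = D (log F) and D L = g, rescaled because the moments
    use 2D. The constants in [g0], ..., [g6] come from [Phi], the Lambert series from [chi]; the odd
    moments of [tz] vanish by reflection. *)
Lemma mom0_tz_recursion (q : C) : q <> 0 -> (Cmod q < 1)%R ->
  let F := mom0 (tz q) in
  let g0 := / 4 + 2 * lambert 1 q in let g2 := - / 8 + 2 * lambert 3 q in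
  let g4 := / 4 + 2 * lambert 5 q in let g6 := - (17) / 16 + 2 * lambert 7 q in
  F 2%nat = 4 * g0 * F 0%nat /\
  F 4%nat = 12 * g0 * F 2%nat + 16 * g2 * F 0%nat /\
  F 6%nat = 20 * g0 * F 4%nat + 160 * g2 * F 2%nat + 64 * g4 * F 0%nat /\
  F 8%nat = 28 * g0 * F 6%nat + 560 * g2 * F 4%nat + 1344 * g4 * F 2%nat
    + 256 * g6 * F 0%nat.
Proof.
intros Hq0 Hq F g0 g2 g4 g6.
assert (Ht := geoZ_tz q Hq0 Hq). assert (HP := geoZ_Phi q Hq0 Hq).
assert (Hc := geoZ_chi q Hq0 Hq).
destruct (chi_moments q Hq0 Hq) as [[X0 [X2 [X4 X6]]] [X1 [X3 [X5 X7]]]]. cbv beta in *.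
assert (F1 : F 1%nat = 0) by exact (mom0_odd q 0 Hq0 Hq).
assert (F3 : F 3%nat = 0) by exact (mom0_odd q 1 Hq0 Hq).
assert (F5 : F 5%nat = 0) by exact (mom0_odd q 2 Hq0 Hq).
assert (F7 : F 7%nat = 0) by exact (mom0_odd q 3 Hq0 Hq).
set (M := mom0 (Phi q)).
assert (HM : forall k, mom (Phi q) 0 (- 1) k + mom (Phi q) 0 1 k =
    / 2 * mom (tz q) 0 1 k + - / 2 * mom (tz q) 0 (- 1) k)
  by (intros k; now apply mom_Phi).
destruct (euler_odd_expand (mom (Phi q)) (mom (tz q)) M F) as [M1 [M3 [M5 M7]]];
  [intros; now apply mom_S|intros; apply mom_O|intros; now apply mom_S|intros; apply mom_O
  |exact HM|].
assert (HF : forall k, F (S k) = 2 * M k + 2 * bimom (tz q) (chi q) 0 0 k).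
{ intros k. unfold F, M. rewrite mom0_tz_step, mom0_Psi by assumption. reflexivity. }
destruct (binomial_odd_expand (bimom (tz q) (chi q)) F
  (fun b => Zsum (fun m => even_int m ^ b * chi q m))) as [B1 [B3 [B5 B7]]].
{ intros. now apply bimom_S. }
{ intros. now apply bimom_O. }
cbv beta in B1, B3, B5, B7.
rewrite X0, X1 in B1. rewrite X0, X1, X2, X3 in B3. rewrite X0, X1, X2, X3, X4, X5 in B5.
rewrite X0, X1, X2, X3, X4, X5, X6, X7 in B7.
unfold g0, g2, g4, g6. repeat split.
- rewrite (HF 1%nat), B1, F1, M1. field.
- rewrite (HF 3%nat), B3, F1, F3, M3, M1. field.
- rewrite (HF 5%nat), B5, F1, F3, F5, M5, M3, M1. field.
- rewrite (HF 7%nat), B7, F1, F3, F5, F7, M7, M5, M3, M1. field.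
Qed.

(** * The identities *)

Lemma calP_lambert (q : C) : calP q = 1 + 8 * lambert 1 q.
Proof.
unfold calP, CSeries_from1, lambert. do 2 f_equal. apply CSeries_ext. intros n.
rewrite Nat.sub_1_r. simpl Nat.pred. unfold Cdiv. ring.
Qed.

Lemma calQ_lambert (q : C) : calQ q = 1 - 16 * lambert 3 q.
Proof.
unfold calQ, CSeries_from1, lambert. do 2 f_equal. apply CSeries_ext. intros n.
rewrite Nat.sub_1_r. simpl Nat.pred. unfold Cdiv. ring.
Qed.

Lemma cale_eser (q : C) : cale q = eser q.
Proof.
unfold cale, CSeries_from1, eser. do 2 f_equal. apply CSeries_ext. intros n.
unfold Cdiv. ring.
Qed.

Lemma identities_nonzero (q : C) : q <> 0 -> (Cmod q < 1)%R ->
     calT 1 q = psi q * calP q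
  /\ calT 2 q = psi q * (3 * calP q ^ 2 - 2 * calQ q)
  /\ calT 3 q =
       psi q * (15 * calP q ^ 3 - 30 * calP q * calQ q + 16 * cale q * calQ q)
  /\ calT 4 q =
       psi q * (105 * calP q ^ 4 - 420 * calP q ^ 2 * calQ q
                + 448 * cale q * calP q * calQ q
                - 128 * cale q ^ 2 * calQ q - 4 * calQ q ^ 2).
Proof.
intros Hq0 Hq.
destruct (mom0_tz_recursion q Hq0 Hq) as [E2 [E4 [E6 E8]]].
destruct (G_lambert q Hq0 Hq) as [L1 [L3 [L5 L7]]].
rewrite <- L1 in E2, E4, E6, E8. rewrite <- L3 in E4, E6, E8. rewrite <- L5 in E6, E8.
rewrite <- L7 in E8.
assert (H4 := G4_relation q Hq0 Hq). assert (H6 := G6_relation q Hq0 Hq).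
rewrite G0_sigma_eser, <- cale_eser in H4, H6 by assumption.
assert (HP : G0 q = calP q / 4) by (rewrite calP_lambert, L1; field).
assert (HQ : G2 q = - calQ q / 8) by (rewrite calQ_lambert, L3; field).
rewrite H6, H4, HP, HQ in E8. rewrite H4, HP, HQ in E6. rewrite HP, HQ in E4. rewrite HP in E2.
rewrite (mom0_psi q Hq0 Hq) in E2, E4, E6, E8.
assert (HT : forall k V, mom0 (tz q) (2 * k) = 2 * V -> calT k q = V).
{ intros k V H. rewrite mom0_calT in H by assumption.
  replace (calT k q) with (2 * calT k q / 2) by field. rewrite H. field. }
rewrite E2 in E4, E6, E8. rewrite E4 in E6, E8. rewrite E6 in E8.
repeat split; apply HT; simpl Nat.mul.
- rewrite E2. field.
- rewrite E4. field.
- rewrite E6. field.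
- rewrite E8. field.
Qed.

(** * The case q = 0 and the conclusion *)

Lemma CSeries_0 (a : nat -> C) : (forall n, a n = 0) -> CSeries a = 0.
Proof.
intros H. apply CSeries_unique. apply is_series_C_spec. intros eps Heps. exists O. intros n _.
replace (sum_n a n - 0) with (RtoC 0); [now rewrite Cmod_0|].
induction n as [|n IH]; [rewrite sum_O|rewrite sum_Sn; change plus with Cplus]; rewrite H.
- ring.
- rewrite Cplus_0_r. exact IH.
Qed.

Lemma values_at_0 : psi 0 = 1 /\ (forall k, calT k 0 = 1) /\
  calP 0 = 1 /\ cale 0 = 1 /\ calQ 0 = 1.
Proof.
assert (Hp : forall n, RtoC 0 ^ S n = 0) by (intros n; rewrite Cpow_S; ring).
assert (Ht : forall n, RtoC 0 ^ triangular (S n) = 0).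
{ intros n. rewrite <- tri_triangular. pose proof (tri_spec (Z.of_nat (S n))) as H.
  replace (tri (Z.of_nat (S n))) with (S (tri (Z.of_nat (S n)) - 1)) by nia. apply Hp. }
repeat split.
- unfold psi. rewrite CSeries_S.
  + rewrite CSeries_0 by exact Ht. change (triangular 0) with O. simpl. ring.
  + exists 1%R, (/ 2)%R. split; [lra|]. intros [|n].
    * change (triangular 0) with O. simpl. rewrite Cmod_1. lra.
    * rewrite Ht, Cmod_0. assert (0 < (/ 2) ^ S n)%R by (apply pow_lt; lra). lra.
- intros k. unfold calT, CSeries_from1. rewrite CSeries_0; [ring|].
  intros n. rewrite Ht. ring.
- unfold calP, CSeries_from1. rewrite CSeries_0; [ring|].
  intros n. rewrite Hp. unfold Cdiv. ring.
- unfold cale, CSeries_from1. rewrite CSeries_0; [ring|].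
  intros n. rewrite Hp. unfold Cdiv. ring.
- unfold calQ, CSeries_from1. rewrite CSeries_0; [ring|].
  intros n. rewrite Hp. unfold Cdiv. ring.
Qed.

Theorem theorem4p1 :
  forall q : C, (Cmod q < 1)%R ->
    (psi q <> 0 ->
       calT 1 q / psi q = calP q
    /\ calT 2 q / psi q = 3 * calP q ^ 2 - 2 * calQ q
    /\ calT 3 q / psi q =
         15 * calP q ^ 3 - 30 * calP q * calQ q + 16 * cale q * calQ q
    /\ calT 4 q / psi q =
         105 * calP q ^ 4 - 420 * calP q ^ 2 * calQ q
         + 448 * cale q * calP q * calQ q
         - 128 * cale q ^ 2 * calQ q - 4 * calQ q ^ 2)
    /\
    (  calT 1 q = psi q * calP q
    /\ calT 2 q = psi q * (3 * calP q ^ 2 - 2 * calQ q)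
    /\ calT 3 q =
         psi q * (15 * calP q ^ 3 - 30 * calP q * calQ q
                  + 16 * cale q * calQ q)
    /\ calT 4 q =
         psi q * (105 * calP q ^ 4 - 420 * calP q ^ 2 * calQ q
                  + 448 * cale q * calP q * calQ q
                  - 128 * cale q ^ 2 * calQ q - 4 * calQ q ^ 2)).
Proof.
intros q Hq.
match goal with |- _ /\ ?B => assert (H : B) end.
(* At q = 0 all the functions equal 1, and the identities become 1 = 3 - 2, 1 = 15 - 30 + 16 and 1 =
   105 - 420 + 448 - 128 - 4, besides 1 = 1. *)
{ destruct (Ceq_dec q 0) as [->|Hq0].
  - destruct values_at_0 as [Hpsi [HT [HP [He HQ]]]]. rewrite !HT, Hpsi, HP, He, HQ.
    repeat split; ring.
  - exact (identities_nonzero q Hq0 Hq). }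
split; [|exact H]. intros Hpsi. destruct H as [-> [-> [-> ->]]].
repeat split; field; exact Hpsi.
Qed.
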